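(* Assume that $\sum_{n=0}^\infty a_n^{-1}<\infty$, that $\beta_n\to\beta_\infty$ as $n\to\infty$ with $|\beta_\infty|<1$, and that $(k_n-1)\in\ell^1(\mathbb{Z}_+)$ and $(\beta_{n+1}-\beta_n)\in\ell^1(\mathbb{Z}_+)$. For $\omega\in\mathbb{T}=\{\omega\in\mathbb{C}:|\omega|=1\}$ let $\mathbf{J}_\omega$ be the restriction of $J_{\max}$ to $$\mathcal{D}(\mathbf{J}_\omega)=\{u\in\mathcal{D}(J_{\max}): s_+(u)=\omega\, s_-(u)\}.$$ Then for all $\omega\in\mathbb{T}$ the operator $\mathbf{J}_\omega$ is self-adjoint. Conversely, every operator $J$ such that $J_{\min}\subset J=J^*\subset J_{\max}$ equals $\mathbf{J}_\omega$ for some $\omega\in\mathbb{T}$.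
   Context: Let $\mathbb{Z}_+=\{0,1,2,\dots\}$, let $a_n>0$ and $b_n\in\mathbb{R}$ for $n\in\mathbb{Z}_+$, and for a sequence $u=(u_n)_{n\ge 0}$ of complex numbers put $(\mathcal{J}u)_0=b_0u_0+a_0u_1$ and $(\mathcal{J}u)_n=a_{n-1}u_{n-1}+b_nu_n+a_nu_{n+1}$ for $n\ge 1$. The space $\ell^2(\mathbb{Z}_+)$ has scalar product $\langle u,v\rangle=\sum_n u_n\overline{v_n}$. The operator $J_{\min}$ acts by $J_{\min}u=\mathcal{J}u$ on the set of finitely supported sequences; $J_{\max}$ acts by $J_{\max}u=\mathcal{J}u$ on $\mathcal{D}(J_{\max})=\{u\in\ell^2(\mathbb{Z}_+):\mathcal{J}u\in\ell^2(\mathbb{Z}_+)\}$; one has $J_{\min}^*=J_{\max}$. Put $\beta_n=-\dfrac{b_n}{2\sqrt{a_{n-1}a_n}}$ and $k_n=\dfrac{a_n}{\sqrt{a_{n-1}a_{n+1}}}$, where for $n=0$ an arbitrary fixed number $a_{-1}>0$ (for instance $a_{-1}=1$) is used. Put $\theta_n=\arccos\beta_n$ (when $|\beta_n|\le 1$) and $\varphi_n=\sum_{m}\theta_m$, the sum being over those $m\in\{0,\dots,n-1\}$ with $|\beta_m|\le1$. Under the assumptions of the statement, every $u=(u_n)\in\mathcal{D}(J_{\max})$ has the asymptotics $$u_n=a_n^{-1/2}\big(s_+e^{i\varphi_n}+s_-e^{-i\varphi_n}+o(1)\big),\qquad n\to\infty,$$ for uniquely determined numbers $s_\pm=s_\pm(u)\in\mathbb{C}$;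 this defines $s_\pm(u)$. *)

(* Defs.v *)
From Stdlib Require Import Reals ClassicalEpsilon.
From Coquelicot Require Import Coquelicot.

Open Scope R_scope.
Open Scope C_scope.

Definition cseq := nat -> C.

Definition zero_seq : cseq := fun _ => RtoC 0.

Definition l2 (u : cseq) : Prop := ex_series (fun n => (Cmod (u n) ^ 2)%R).

(* Coquelicot's [Series] is real-valued, so the complex sum
   [sum_n u_n * conj v_n] is taken componentwise. *)
Definition inner (u v : cseq) : C :=
  (Series (fun n => Re (u n * Cconj (v n))),
   Series (fun n => Im (u n * Cconj (v n)))).

Definition l2norm (u : cseq) : R := sqrt (Series (fun n => (Cmod (u n) ^ 2)%R)).

(* A partially defined map on sequences; [opfun] is only meaningful on [dom],
   so operators are compared with [op_eq] and not with [=]. *)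
Record operator := Operator {
  dom : cseq -> Prop;
  opfun : cseq -> cseq
}.

Definition op_incl (A B : operator) : Prop :=
  forall u, dom A u -> dom B u /\ opfun A u = opfun B u.

Definition op_eq (A B : operator) : Prop := op_incl A B /\ op_incl B A.

Definition restriction (A : operator) (D : cseq -> Prop) : operator :=
  Operator (fun u => dom A u /\ D u) (opfun A).

Definition linear_operator (A : operator) : Prop :=
  (forall u, dom A u -> l2 u /\ l2 (opfun A u)) /\
  dom A zero_seq /\
  (forall (c : C) (u v : cseq), dom A u -> dom A v ->
     dom A (fun n => c * u n + v n) /\
     opfun A (fun n => c * u n + v n)
       = (fun n => c * opfun A u n + opfun A v n)).

Definition densely_defined (A : operator) : Prop :=
  forall u, l2 u -> forall eps : R, (0 < eps)%R ->
  exists v, dom A v /\ (l2norm (fun n => (u n - v n)%C) < eps)%R.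

Definition adjoint_rel (A : operator) (v w : cseq) : Prop :=
  l2 v /\ l2 w /\ forall u, dom A u -> inner (opfun A u) v = inner u w.

(* [w] is unique in [adjoint_rel A v w] when [A] is densely defined, so the
   choice made here is then forced on the domain of the adjoint. *)
Definition adjoint (A : operator) : operator :=
  Operator (fun v => exists w, adjoint_rel A v w)
           (fun v => @epsilon cseq (inhabits zero_seq) (adjoint_rel A v)).

Definition self_adjoint (A : operator) : Prop :=
  linear_operator A /\ densely_defined A /\ op_eq A (adjoint A).

Definition jacobi (a b : nat -> R) (u : cseq) : cseq := fun n =>
  match n with
  | O => b 0%nat * u 0%nat + a 0%nat * u 1%nat
  | S m => a m * u m + b n * u n + a n * u (S n)
  end.

Definition Jmin (a b : nat -> R) : operator :=
  Operator (fun u => exists N, forall n, (N <= n)%nat -> u n = 0) (jacobi a b).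

Definition Jmax (a b : nat -> R) : operator :=
  Operator (fun u => l2 u /\ l2 (jacobi a b u)) (jacobi a b).

(* [a_pred am1 a n] is a_{n-1}, with a_{-1} = am1. *)
Definition a_pred (am1 : R) (a : nat -> R) (n : nat) : R :=
  match n with O => am1 | S m => a m end.

Definition beta (am1 : R) (a b : nat -> R) (n : nat) : R :=
  (- (b n / (2 * sqrt (a_pred am1 a n * a n))))%R.

Definition kappa (am1 : R) (a : nat -> R) (n : nat) : R :=
  (a n / sqrt (a_pred am1 a n * a (S n)))%R.

Definition theta (am1 : R) (a b : nat -> R) (n : nat) : R :=
  acos (beta am1 a b n).

Fixpoint phi (am1 : R) (a b : nat -> R) (n : nat) : R :=
  match n with
  | O => 0%R
  | S m => (phi am1 a b m +
            if Rle_dec (Rabs (beta am1 a b m)) 1 then theta am1 a b m else 0)%R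
  end.

(* e^{i t} *)
Definition expi (t : R) : C := (cos t, sin t).

Definition asymptotics (am1 : R) (a b : nat -> R) (u : cseq) (s : C * C) : Prop :=
  exists e : cseq,
    is_lim_seq (fun n => Cmod (e n)) 0%R /\
    forall n, u n = (/ sqrt (a n))%R *
      (fst s * expi (phi am1 a b n) + snd s * expi (- phi am1 a b n)%R + e n).

(* The pair (s_+(u), s_-(u)); an arbitrary value if no pair satisfies
   [asymptotics]. *)
Definition s_pair (am1 : R) (a b : nat -> R) (u : cseq) : C * C :=
  epsilon (inhabits (RtoC 0, RtoC 0)) (asymptotics am1 a b u).

Definition s_plus am1 a b u : C := fst (s_pair am1 a b u).
Definition s_minus am1 a b u : C := snd (s_pair am1 a b u).

Definition J_omega (am1 : R) (a b : nat -> R) (omega : C) : operator :=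
  restriction (Jmax a b)
    (fun u => s_plus am1 a b u = omega * s_minus am1 a b u).

(* Main.v *)
Require Import Defs.
From Stdlib Require Import Reals Lra Lia FunctionalExtensionality ClassicalEpsilon.
From Coquelicot Require Import Coquelicot.

(** Put [y_n = sqrt (a_n) u_n].  The equation [J u = f] becomes
    [y_{n-1} - 2 beta_n y_n + k_n y_{n+1} = f_n / sqrt (a_{n-1})], whose right-hand side is
    summable by Cauchy-Schwarz.  The amplitudes
    [A_n = e^{-i phi_n} (y_{n+1} - e^{-i theta_n} y_n)] and
    [B_n = e^{i phi_n} (y_{n+1} - e^{i theta_n} y_n)] have increments controlled by
    [|e^{i theta_{n+1}} - e^{i theta_n}|], [|k_n - 1|] and [|f_n| / sqrt (a_{n-1})], so a discrete
    Gronwall inequality bounds them and they converge; their limits are, up to a nonzero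
    factor, [s_+] and [- s_-].  The Wronskian equals [sqrt (a_n / a_{n+1})], which stays
    between two positive constants, times a bracket converging to a nonzero multiple of
    [s_+(u) s_-(v) - s_-(u) s_+(v)].  With Green's formula, [<J u, v> = <u, J v>] holds if and only if
    [s_+(u) conj (s_+(v)) = s_-(u) conj (s_-(v))].  Since [(s_+, s_-)] maps the domain of
    [Jmax] onto [C^2], self-adjoint restrictions correspond to maximal isotropic subspaces
    of this form, i.e. to the lines [s_+ = omega s_-]. *)

Open Scope R_scope.

(** * A discrete Gronwall inequality *)

Lemma ex_series_shift (a : nat -> R) (N : nat) :
  ex_series a -> ex_series (fun n => a (n + N)%nat).
Proof.
  intros H. apply (ex_series_incr_n a N) in H.
  revert H. apply ex_series_ext. intros n. f_equal. lia.
Qed.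

Lemma ex_series_dominated (a b : nat -> R) :
  (forall n, Rabs (a n) <= b n) -> ex_series b -> ex_series a.
Proof. intros H. apply (ex_series_le (K := R_AbsRing) (V := R_CompleteNormedModule)). exact H. Qed.

Lemma ex_series_Rscal (c : R) (a : nat -> R) :
  ex_series a -> ex_series (fun n => c * a n).
Proof. apply (ex_series_scal_l c a). Qed.

Lemma ex_series_Rplus (a b : nat -> R) :
  ex_series a -> ex_series b -> ex_series (fun n => a n + b n).
Proof. apply (ex_series_plus a b). Qed.

Lemma sum_n_nonneg_bounded (a : nat -> R) :
  (forall n, 0 <= a n) -> ex_series a ->
  exists K, 0 <= K /\ forall n, sum_n a n <= K.
Proof.
  intros Ha Hs. exists (Series a).
  assert (H : forall n, sum_n a n <= Series a).
  { intros n. apply (is_lim_seq_incr_compare (sum_n a)).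
    - apply Series_correct, Hs.
    - intros m. rewrite sum_Sn. unfold plus; simpl. specialize (Ha (S m)). lra. }
  split; [|exact H].
  apply Rle_trans with (sum_n a 0); [rewrite sum_O; apply Ha | apply H].
Qed.

(** Since [1 + x <= exp x], iterating the recursion keeps [M (S n)] below
    [exp (sum_n d n) * (M O + sum_n g n)], and both sums are bounded. *)
Lemma discrete_gronwall (M d g : nat -> R) :
  (forall n, 0 <= M n) -> (forall n, 0 <= d n) -> (forall n, 0 <= g n) ->
  ex_series d -> ex_series g ->
  (forall n, M (S n) <= (1 + d n) * M n + g n) ->
  exists K, 0 < K /\ forall n, M n <= K.
Proof.
  intros HM Hd Hg Sd Sg Hrec.
  destruct (sum_n_nonneg_bounded d Hd Sd) as [D [HD0 HD]].
  destruct (sum_n_nonneg_bounded g Hg Sg) as [G [HG0 HG]].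
  assert (Hn : forall n, M (S n) <= exp (sum_n d n) * (M O + sum_n g n)).
  { induction n as [|n IH].
    - rewrite !sum_O. specialize (Hrec O).
      pose proof (exp_ineq1_le (d O)). pose proof (HM O). pose proof (Hg O).
      pose proof (Hd O).
      assert (0 <= (exp (d O) - (1 + d O)) * M O) by (apply Rmult_le_pos; lra).
      assert (0 <= (exp (d O) - 1) * g O) by (apply Rmult_le_pos; lra).
      lra.
    - rewrite !sum_Sn. unfold plus; simpl.
      rewrite exp_plus.
      pose proof (exp_ineq1_le (d (S n))). pose proof (Hd (S n)).
      pose proof (Hg (S n)). specialize (Hrec (S n)). pose proof (HM (S n)).
      assert (0 <= sum_n d n).
      { rewrite sum_n_Reals. apply cond_pos_sum, Hd. }
      pose proof (exp_ineq1_le (sum_n d n)).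
      set (e1 := exp (sum_n d n)) in *. set (e2 := exp (d (S n))) in *.
      set (X := M O + sum_n g n) in *.
      (* The new term [g (S n)] arrives with coefficient 1; this bound lets it enter the bracket
         multiplied by [e1 * e2]. *)
      assert (1 <= e1 * e2) by nra.
      assert ((1 + d (S n)) * M (S n) <= e2 * (e1 * X)).
      { apply Rmult_le_compat; lra. }
      assert (0 <= (e1 * e2 - 1) * g (S n)) by (apply Rmult_le_pos; lra).
      replace (M O + (sum_n g n + g (S n))) with (X + g (S n)) by (unfold X; ring).
      lra. }
  (* The iterated bound starts at index 1. The summand [M O] covers index 0, and [1] makes the
     constant strictly positive. *)
  exists (exp D * (M O + G) + M O + 1).
  assert (0 <= exp D * (M O + G)).
  { apply Rmult_le_pos; [left; apply exp_pos | pose proof (HM O); lra]. }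
  split; [pose proof (HM O); lra|].
  intros [|n]; [lra|].
  apply Rle_trans with (exp D * (M O + G)); [|pose proof (HM O); lra].
  eapply Rle_trans; [apply Hn|].
  apply Rmult_le_compat.
  - left; apply exp_pos.
  - assert (0 <= sum_n g n) by (rewrite sum_n_Reals; apply cond_pos_sum, Hg).
    pose proof (HM O); lra.
  - destruct (HD n); [left; apply exp_increasing; assumption | right; f_equal; assumption].
  - pose proof (HG n); lra.
Qed.

Open Scope C_scope.

(** * Limits of complex sequences *)

Definition Clim (f : nat -> C) (l : C) : Prop :=
  is_lim_seq (fun n => Cmod (f n - l)) 0%R.

Lemma Clim_squeeze (f : nat -> C) (l : C) (e : nat -> R) (N : nat) :
  (forall n, (N <= n)%nat -> (Cmod (f n - l) <= e n)%R) ->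
  is_lim_seq e 0%R -> Clim f l.
Proof.
  intros H He. unfold Clim.
  apply is_lim_seq_le_le_loc with (u := fun _ => 0%R) (w := e).
  - exists N. intros n Hn. split; [apply Cmod_ge_0 | apply H, Hn].
  - apply is_lim_seq_const.
  - exact He.
Qed.

Lemma Clim_ext_loc (f g : nat -> C) (l : C) (N : nat) :
  (forall n, (N <= n)%nat -> f n = g n) -> Clim f l -> Clim g l.
Proof.
  intros H Hf. apply Clim_squeeze with (fun n => Cmod (f n - l)) N; [|exact Hf].
  intros n Hn. rewrite (H n Hn). apply Rle_refl.
Qed.

Lemma Clim_ext (f g : nat -> C) (l : C) :
  (forall n, f n = g n) -> Clim f l -> Clim g l.
Proof. intros H. apply (Clim_ext_loc f g l O). intros n _; apply H. Qed.

Lemma Clim_shift (f : nat -> C) (l : C) (N : nat) :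
  Clim f l <-> Clim (fun n => f (n + N)%nat) l.
Proof. apply (is_lim_seq_incr_n (fun n => Cmod (f n - l)) N). Qed.

Lemma Clim_const (l : C) : Clim (fun _ => l) l.
Proof.
  apply Clim_squeeze with (fun _ => 0%R) O; [|apply is_lim_seq_const].
  intros n _. replace (l - l) with (RtoC 0) by ring. rewrite Cmod_0. apply Rle_refl.
Qed.

Lemma is_lim_seq_plus_0 (u v : nat -> R) :
  is_lim_seq u 0%R -> is_lim_seq v 0%R -> is_lim_seq (fun n => (u n + v n)%R) 0%R.
Proof.
  intros Hu Hv. replace 0%R with (0 + 0)%R by ring. now apply is_lim_seq_plus'.
Qed.

Lemma is_lim_seq_scal_0 (c : R) (u : nat -> R) :
  is_lim_seq u 0%R -> is_lim_seq (fun n => (c * u n)%R) 0%R.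
Proof.
  intros Hu. replace 0%R with (c * 0)%R by ring.
  apply (is_lim_seq_scal_l u c 0%R Hu).
Qed.

Lemma Clim_plus (f g : nat -> C) (l m : C) :
  Clim f l -> Clim g m -> Clim (fun n => f n + g n) (l + m).
Proof.
  intros Hf Hg.
  apply Clim_squeeze with (fun n => Cmod (f n - l) + Cmod (g n - m))%R O.
  - intros n _. replace (f n + g n - (l + m)) with ((f n - l) + (g n - m)) by ring.
    apply Cmod_triangle.
  - now apply is_lim_seq_plus_0.
Qed.

Lemma Clim_mult (f g : nat -> C) (l m : C) :
  Clim f l -> Clim g m -> Clim (fun n => f n * g n) (l * m).
Proof.
  intros Hf Hg.
  apply Clim_squeeze with
    (fun n => Cmod (f n - l) * Cmod (g n - m)
              + (Cmod l * Cmod (g n - m) + Cmod m * Cmod (f n - l)))%R O.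
  - intros n _.
    replace (f n * g n - l * m)
      with ((f n - l) * (g n - m) + (l * (g n - m) + m * (f n - l))) by ring.
    rewrite <- !Cmod_mult.
    eapply Rle_trans; [apply Cmod_triangle|]. apply Rplus_le_compat_l, Cmod_triangle.
  - apply is_lim_seq_plus_0.
    + replace 0%R with (0 * 0)%R by ring. now apply is_lim_seq_mult'.
    + apply is_lim_seq_plus_0; now apply is_lim_seq_scal_0.
Qed.

Lemma Clim_scal (c : C) (f : nat -> C) (l : C) :
  Clim f l -> Clim (fun n => c * f n) (c * l).
Proof. intros H. apply (Clim_mult (fun _ => c)); [apply Clim_const | exact H]. Qed.

Lemma Clim_minus (f g : nat -> C) (l m : C) :
  Clim f l -> Clim g m -> Clim (fun n => f n - g n) (l - m).
Proof.
  intros Hf Hg. replace (l - m) with (l + (- (1)) * m) by ring.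
  apply Clim_ext with (fun n => f n + (- (1)) * g n); [intros n; ring|].
  apply Clim_plus; [exact Hf | now apply Clim_scal].
Qed.

Lemma Clim_conj (f : nat -> C) (l : C) :
  Clim f l -> Clim (fun n => Cconj (f n)) (Cconj l).
Proof.
  intros H. apply Clim_squeeze with (fun n => Cmod (f n - l)) O; [|exact H].
  intros n _. rewrite <- Cminus_conj, Cmod_conj. apply Rle_refl.
Qed.

Lemma Clim_unique (f : nat -> C) (l m : C) : Clim f l -> Clim f m -> l = m.
Proof.
  intros Hl Hm. pose proof (Clim_minus _ _ _ _ Hl Hm) as H.
  assert (H0 : is_lim_seq (fun _ => Cmod (l - m)) 0%R).
  { revert H. unfold Clim. apply is_lim_seq_ext. intros n.
    rewrite <- (Cmod_opp (l - m)). f_equal. ring. }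
  apply is_lim_seq_unique in H0. rewrite Lim_seq_const in H0.
  injection H0 as H0. apply Cmod_eq_0 in H0.
  replace l with ((l - m) + m) by ring. rewrite H0. ring.
Qed.

Lemma Clim_bounded_mult_0 (c f : nat -> C) (K : R) (N : nat) :
  (forall n, (N <= n)%nat -> (Cmod (c n) <= K)%R) ->
  Clim f 0 -> Clim (fun n => c n * f n) 0.
Proof.
  intros Hc Hf. apply Clim_squeeze with (fun n => K * Cmod (f n - 0))%R N.
  - intros n Hn. replace (c n * f n - 0) with (c n * (f n - 0)) by ring.
    rewrite Cmod_mult. apply Rmult_le_compat_r; [apply Cmod_ge_0 | apply Hc, Hn].
  - now apply is_lim_seq_scal_0.
Qed.

Lemma Cmod_le_Rabs (c : C) : (Cmod c <= Rabs (Re c) + Rabs (Im c))%R.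
Proof.
  apply Rsqr_incr_0_var; [|pose proof (Rabs_pos (Re c)); pose proof (Rabs_pos (Im c)); lra].
  pose proof (Cmod2_alt c) as H. unfold Rsqr.
  rewrite <- (pow2_abs (Re c)), <- (pow2_abs (Im c)) in H.
  pose proof (Rabs_pos (Re c)). pose proof (Rabs_pos (Im c)). nra.
Qed.

Lemma Rabs_im_le_Cmod (c : C) : (Rabs (Im c) <= Cmod c)%R.
Proof. eapply Rle_trans; [apply Rmax_r | apply (Rmax_Cmod c)]. Qed.

Lemma Clim_components (f : nat -> C) (l : C) :
  is_lim_seq (fun n => Re (f n)) (Re l) -> is_lim_seq (fun n => Im (f n)) (Im l) ->
  Clim f l.
Proof.
  intros HR HI.
  apply Clim_squeeze with (fun n => Rabs (Re (f n) - Re l) + Rabs (Im (f n) - Im l))%R O.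
  - intros n _. apply Cmod_le_Rabs.
  - apply is_lim_seq_plus_0; apply -> is_lim_seq_abs_0.
    + replace 0%R with (Re l - Re l)%R by ring.
      apply is_lim_seq_minus'; [exact HR | apply is_lim_seq_const].
    + replace 0%R with (Im l - Im l)%R by ring.
      apply is_lim_seq_minus'; [exact HI | apply is_lim_seq_const].
Qed.

Lemma sum_n_Re (f : nat -> C) (n : nat) : Re (sum_n f n) = sum_n (fun k => Re (f k)) n.
Proof. induction n as [|n IH]; rewrite ?sum_O, ?sum_Sn; [|rewrite <- IH]; reflexivity. Qed.

Lemma sum_n_Im (f : nat -> C) (n : nat) : Im (sum_n f n) = sum_n (fun k => Im (f k)) n.
Proof. induction n as [|n IH]; rewrite ?sum_O, ?sum_Sn; [|rewrite <- IH]; reflexivity. Qed.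

(** The limit is written componentwise to match [inner], which thereby becomes a limit of complex
    partial sums. *)
Lemma Clim_sum_n (f : nat -> C) :
  ex_series (fun n => Cmod (f n)) ->
  Clim (sum_n f) (Series (fun n => Re (f n)), Series (fun n => Im (f n))).
Proof.
  intros H. apply Clim_components.
  - apply is_lim_seq_ext with (sum_n (fun n => Re (f n))); [intros n; now rewrite sum_n_Re|].
    apply Series_correct. revert H. apply ex_series_dominated.
    intros n; apply re_le_Cmod.
  - apply is_lim_seq_ext with (sum_n (fun n => Im (f n))); [intros n; now rewrite sum_n_Im|].
    apply Series_correct. revert H. apply ex_series_dominated.
    intros n; apply Rabs_im_le_Cmod.
Qed.

Lemma Clim_of_summable_increments (A : nat -> C) :
  ex_series (fun n => Cmod (A (S n) - A n)) -> exists l, Clim A l.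
Proof.
  (* The increments with indices [0] to [n] telescope to [A (S n) - A O], hence the shift by one. *)
  intros H. eexists. apply (Clim_shift A _ 1).
  apply Clim_ext with (fun n => A O + sum_n (fun k => A (S k) - A k) n).
  - intros n. rewrite Nat.add_1_r. induction n as [|n IH].
    + rewrite sum_O. ring.
    + rewrite sum_Sn. change plus with Cplus. rewrite Cplus_assoc, IH. ring.
  - apply Clim_plus; [apply Clim_const | apply Clim_sum_n, H].
Qed.

(** * Oscillating three-term recurrences *)

Lemma Clim_lower_bound (f : nat -> C) (l : C) (s : R) :
  (forall n, s <= Cmod (f n))%R -> Clim f l -> (s <= Cmod l)%R.
Proof.
  intros Hs Hf.
  assert (H : Rbar_le (s - Cmod l)%R 0%R).
  { apply is_lim_seq_le with (fun _ => (s - Cmod l)%R) (fun n => Cmod (f n - l)).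
    - intros n. specialize (Hs n).
      pose proof (Cmod_triangle (f n - l) l) as H.
      replace (f n - l + l) with (f n) in H by ring. lra.
    - apply is_lim_seq_const.
    - exact Hf. }
  simpl in H. lra.
Qed.

Lemma Cconj_unit (w : C) : Cmod w = 1%R -> w * Cconj w = 1.
Proof.
  intros H. rewrite <- Cmod2_conj, H. apply injective_projections; simpl; ring.
Qed.

Lemma Cmod_minus_conj (w : C) : Cmod (w - Cconj w) = (2 * Rabs (Im w))%R.
Proof.
  rewrite im_alt', !Cmod_mult, Cmod_Ci, !Cmod_R, (Rabs_pos_eq 2) by lra. ring.
Qed.

(* Here [z n] plays the role of e^{i theta_n} and [E n] that of e^{i phi_n}. *)
Record oscillating (z E : nat -> C) (k : nat -> R) (sigma : R) : Prop := {
  osc_sigma : (0 < sigma)%R;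
  osc_z : forall n, Cmod (z n) = 1%R;
  osc_E : forall n, Cmod (E n) = 1%R;
  osc_step : forall n, E (S n) = z n * E n;
  osc_im : forall n, (sigma <= Rabs (Im (z n)))%R;
  osc_dz : ex_series (fun n => Cmod (z (S n) - z n));
  osc_k : forall n, (Rabs (k n - 1) <= 1 / 2)%R;
  osc_dk : ex_series (fun n => Rabs (k n - 1))
}.

Arguments osc_sigma {z E k sigma} _.
Arguments osc_z {z E k sigma} _.
Arguments osc_E {z E k sigma} _.
Arguments osc_step {z E k sigma} _.
Arguments osc_im {z E k sigma} _.
Arguments osc_dz {z E k sigma} _.
Arguments osc_k {z E k sigma} _.
Arguments osc_dk {z E k sigma} _.

(** The coefficient [z + Cconj z] stands for twice [beta]: the unperturbed characteristic polynomial
    factors as [(x - z) (x - Cconj z)]. *)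
Definition three_term (z : nat -> C) (k : nat -> R) (g y : nat -> C) : Prop :=
  forall n, y n - (z (S n) + Cconj (z (S n))) * y (S n) + k n * y (S (S n)) = g n.

Definition conj_seq (y : nat -> C) : nat -> C := fun n => Cconj (y n).

(** The hypotheses are symmetric under conjugation, so each fact about the amplitude of [E] also
    gives the one for [Cconj E]. *)
Lemma oscillating_conj z E k sigma :
  oscillating z E k sigma -> oscillating (conj_seq z) (conj_seq E) k sigma.
Proof.
  intros [Hs Hz HE Hst Him Hdz Hk Hdk]. unfold conj_seq. split; trivial.
  - intros n. now rewrite Cmod_conj.
  - intros n. now rewrite Cmod_conj.
  - intros n. now rewrite Hst, Cmult_conj.
  - intros n. now rewrite im_conj, Rabs_Ropp.
  - revert Hdz. apply ex_series_ext. intros n. now rewrite <- Cminus_conj, Cmod_conj.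
Qed.

Lemma three_term_conj z k g y :
  three_term z k g y -> three_term (conj_seq z) k g y.
Proof.
  intros H n. unfold conj_seq. rewrite Cconj_conj.
  rewrite (Cplus_comm (Cconj _)). apply H.
Qed.

(* Annihilates the component [conj E] and extracts the coefficient of [E]. *)
Definition amplitude (z E y : nat -> C) (n : nat) : C :=
  Cconj (E n) * (y (S n) - Cconj (z n) * y n).

(** For constant [z], [k = 1] and [g = 0] the factorization of the recurrence makes the amplitude
    constant. The increment therefore contains only the three perturbations, each multiplied by a
    factor of modulus one. *)
Lemma amplitude_increment z E k sigma g y (n : nat) :
  oscillating z E k sigma -> three_term z k g y ->
  (Cmod (amplitude z E y (S n) - amplitude z E y n)
   <= Cmod (z (S n) - z n) * Cmod (y (S n))
      + (Rabs (k n - 1) * Cmod (y (S (S n))) + Cmod (g n)))%R.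
Proof.
  intros HO HT.
  assert (Heq : amplitude z E y (S n) - amplitude z E y n
    = Cconj (E n) * (Cconj (z n) * ((z (S n) - z n) * y (S n)))
      + Cconj (E (S n)) * (- RtoC (k n - 1) * y (S (S n)) + g n)).
  { pose proof (Cconj_unit _ (osc_z HO n)) as Hz.
    unfold amplitude. rewrite <- HT, (osc_step HO n), Cmult_conj, RtoC_minus.
    replace (Cconj (z n) * ((z (S n) - z n) * y (S n)))
      with (Cconj (z n) * z (S n) * y (S n) - z n * Cconj (z n) * y (S n)) by ring.
    rewrite Hz. ring. }
  rewrite Heq.
  eapply Rle_trans; [apply Cmod_triangle|].
  rewrite !Cmod_mult, !Cmod_conj, !(osc_E HO), (osc_z HO).
  rewrite !Rmult_1_l. apply Rplus_le_compat_l.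
  eapply Rle_trans; [apply Cmod_triangle|].
  rewrite Cmod_mult, Cmod_opp, Cmod_R. apply Rle_refl.
Qed.

(** The terms in [y (S n)] cancel. As [z - Cconj z] stays away from zero, this recovers [y n] from
    the two amplitudes. *)
Lemma amplitude_difference z E k sigma y (n : nat) :
  oscillating z E k sigma ->
  E n * amplitude z E y n - Cconj (E n) * amplitude (conj_seq z) (conj_seq E) y n
  = (z n - Cconj (z n)) * y n.
Proof.
  intros HO. pose proof (Cconj_unit _ (osc_E HO n)) as HE.
  unfold amplitude, conj_seq. rewrite !Cconj_conj.
  replace (E n * (Cconj (E n) * (y (S n) - Cconj (z n) * y n))
           - Cconj (E n) * (E n * (y (S n) - z n * y n)))
    with (E n * Cconj (E n) * ((z n - Cconj (z n)) * y n)) by ring.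
  rewrite HE. ring.
Qed.

(** Since [k n >= 1 / 2], the recurrence can be solved for [y (S (S n))], which occurs in the
    amplitude increment at [n]. *)
Lemma three_term_step_bound z E k sigma g y (n : nat) :
  oscillating z E k sigma -> three_term z k g y ->
  (Cmod (y (S (S n))) <= 2 * (Cmod (g n) + 2 * Cmod (y (S n)) + Cmod (y n)))%R.
Proof.
  intros HO HT. pose proof (osc_k HO n) as Hk.
  assert (Hk2 : (1 / 2 <= k n)%R) by (apply Rabs_le_between in Hk; lra).
  assert (H : (Cmod (k n * y (S (S n))) <= Cmod (g n) + 2 * Cmod (y (S n)) + Cmod (y n))%R).
  { replace (k n * y (S (S n)))
      with (g n + (z (S n) + Cconj (z (S n))) * y (S n) + - y n).
    - eapply Rle_trans; [apply Cmod_triangle|].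
      rewrite Cmod_opp. apply Rplus_le_compat_r.
      eapply Rle_trans; [apply Cmod_triangle|].
      apply Rplus_le_compat_l. rewrite Cmod_mult.
      apply Rmult_le_compat_r; [apply Cmod_ge_0|].
      eapply Rle_trans; [apply Cmod_triangle|].
      rewrite Cmod_conj, (osc_z HO). lra.
    - rewrite <- (HT n). ring. }
  rewrite Cmod_mult, Cmod_R, Rabs_pos_eq in H by lra.
  pose proof (Cmod_ge_0 (y (S (S n)))). nra.
Qed.

(** The Gronwall inequality is applied to the sum [M] of the moduli of both amplitudes. It controls
    [y n] and [y (S n)], and together with [g n] also [y (S (S n))]. *)
Lemma three_term_bounded z E k sigma g y :
  oscillating z E k sigma -> three_term z k g y ->
  ex_series (fun n => Cmod (g n)) ->
  exists K, (0 < K)%R /\ forall n, (Cmod (y n) <= K)%R.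
Proof.
  intros HO HT Sg.
  pose proof (oscillating_conj _ _ _ _ HO) as HO'.
  pose proof (three_term_conj _ _ _ _ HT) as HT'.
  pose proof (osc_sigma HO) as Hs.
  set (A := amplitude z E y). set (B := amplitude (conj_seq z) (conj_seq E) y).
  set (M := fun n => (Cmod (A n) + Cmod (B n))%R).
  set (K0 := (/ (2 * sigma))%R).
  assert (HK0 : (0 < K0)%R) by (apply Rinv_0_lt_compat; lra).
  assert (Hy0 : forall n, (Cmod (y n) <= K0 * M n)%R).
  { intros n.
    pose proof (amplitude_difference z E k sigma y n HO) as HD. fold A B in HD.
    assert (H1 : (Cmod ((z n - Cconj (z n)) * y n) <= M n)%R).
    { rewrite <- HD. unfold Cminus. eapply Rle_trans; [apply Cmod_triangle|].
      rewrite Cmod_opp, !Cmod_mult, Cmod_conj, (osc_E HO).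
      unfold M; lra. }
    rewrite Cmod_mult, Cmod_minus_conj in H1.
    pose proof (osc_im HO n). pose proof (Cmod_ge_0 (y n)).
    apply Rmult_le_reg_l with (2 * sigma)%R; [lra|].
    unfold K0. rewrite <- Rmult_assoc, Rinv_r, Rmult_1_l by lra. nra. }
  assert (HM0 : forall n, (0 <= M n)%R).
  { intros n. pose proof (Cmod_ge_0 (A n)). pose proof (Cmod_ge_0 (B n)). unfold M; lra. }
  assert (Hy1 : forall n, (Cmod (y (S n)) <= (1 + K0) * M n)%R).
  { intros n.
    assert (H1 : (Cmod (y (S n)) <= Cmod (A n) + Cmod (y n))%R).
    { replace (y (S n)) with ((y (S n) - Cconj (z n) * y n) + Cconj (z n) * y n) by ring.
      eapply Rle_trans; [apply Cmod_triangle|].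
      unfold A, amplitude.
      rewrite !Cmod_mult, !Cmod_conj, (osc_E HO), (osc_z HO). lra. }
    pose proof (Hy0 n). pose proof (Cmod_ge_0 (B n)). unfold M in *. lra. }
  assert (Hy2 : forall n, (Cmod (y (S (S n))) <= 2 * Cmod (g n) + (4 + 6 * K0) * M n)%R).
  { intros n. pose proof (three_term_step_bound _ _ _ _ _ _ n HO HT).
    pose proof (Hy0 n). pose proof (Hy1 n). lra. }
  (* The factor 2 counts the amplitudes, and [4 + 6 * K0] dominates the coefficients of [M n] in
     [Hy1] and [Hy2]. In the forcing term below, each amplitude contributes at most
     [2 * Cmod (g n)], because [Rabs (k n - 1) <= 1 / 2]. *)
  set (d := fun n => (2 * (4 + 6 * K0) * (Cmod (z (S n) - z n) + Rabs (k n - 1)))%R).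
  destruct (discrete_gronwall M d (fun n => 4 * Cmod (g n))%R) as [K [HK HMK]].
  - exact HM0.
  - intros n. unfold d. pose proof (Cmod_ge_0 (z (S n) - z n)).
    pose proof (Rabs_pos (k n - 1)). apply Rmult_le_pos; lra.
  - intros n. pose proof (Cmod_ge_0 (g n)). lra.
  - apply ex_series_Rscal.
    apply ex_series_Rplus.
    + apply (osc_dz HO).
    + apply (osc_dk HO).
  - apply ex_series_Rscal. exact Sg.
  - intros n.
    pose proof (amplitude_increment _ _ _ _ _ _ n HO HT) as HA.
    pose proof (amplitude_increment _ _ _ _ _ _ n HO' HT') as HB.
    (* Only the increment of [conj_seq z] is unfolded; its modulus is that of the increment of
       [z]. *)
    unfold conj_seq at 5 6 in HB. rewrite <- Cminus_conj, Cmod_conj in HB.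
    fold A in HA. fold B in HB.
    pose proof (Cmod_triangle (A (S n) - A n) (A n)) as TA.
    replace (A (S n) - A n + A n) with (A (S n)) in TA by ring.
    pose proof (Cmod_triangle (B (S n) - B n) (B n)) as TB.
    replace (B (S n) - B n + B n) with (B (S n)) in TB by ring.
    specialize (Hy1 n). specialize (Hy2 n).
    pose proof (osc_k HO n) as Hk. pose proof (Rabs_pos (k n - 1)) as Hk0.
    pose proof (Cmod_ge_0 (z (S n) - z n)) as Hz0. pose proof (Cmod_ge_0 (g n)) as Hg0.
    specialize (HM0 n). unfold d.
    change (M (S n)) with (Cmod (A (S n)) + Cmod (B (S n)))%R.
    assert (HMn : M n = (Cmod (A n) + Cmod (B n))%R) by reflexivity.
    set (dz := Cmod (z (S n) - z n)) in *. set (dk := Rabs (k n - 1)) in *.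
    set (G := Cmod (g n)) in *. set (m := M n) in *.
    set (y1 := Cmod (y (S n))) in *. set (y2 := Cmod (y (S (S n)))) in *.
    assert (dz * y1 <= dz * ((4 + 6 * K0) * m))%R
      by (apply Rmult_le_compat_l; nra).
    assert (dk * y2 <= dk * (2 * G + (4 + 6 * K0) * m))%R
      by (apply Rmult_le_compat_l; nra).
    assert (dk * (2 * G) <= G)%R by nra.
    nra.
  - exists (K0 * K)%R. split; [now apply Rmult_lt_0_compat|].
    intros n. eapply Rle_trans; [apply Hy0|]. apply Rmult_le_compat_l; [lra | apply HMK].
Qed.

Lemma amplitude_converges z E k sigma g y :
  oscillating z E k sigma -> three_term z k g y ->
  ex_series (fun n => Cmod (g n)) ->
  exists l, Clim (amplitude z E y) l.
Proof.
  intros HO HT Sg.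
  destruct (three_term_bounded _ _ _ _ _ _ HO HT Sg) as [K [HK Hy]].
  apply Clim_of_summable_increments.
  apply ex_series_dominated with
    (fun n => K * Cmod (z (S n) - z n) + (K * Rabs (k n - 1) + Cmod (g n)))%R.
  - intros n. rewrite Rabs_pos_eq by apply Cmod_ge_0.
    eapply Rle_trans; [apply (amplitude_increment _ _ _ _ _ _ n HO HT)|].
    pose proof (Cmod_ge_0 (z (S n) - z n)). pose proof (Rabs_pos (k n - 1)).
    pose proof (Hy (S n)). pose proof (Hy (S (S n))).
    apply Rplus_le_compat; [|apply Rplus_le_compat_r]; nra.
  - apply ex_series_Rplus.
    + apply ex_series_Rscal, (osc_dz HO).
    + apply ex_series_Rplus; [|exact Sg].
      apply ex_series_Rscal, (osc_dk HO).
Qed.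

Definition asymptotic_to (E y : nat -> C) (s : C * C) : Prop :=
  Clim (fun n => y n - (fst s * E n + snd s * Cconj (E n))) 0.

Lemma asymptotic_to_conj E y s :
  asymptotic_to E y s -> asymptotic_to (conj_seq E) y (snd s, fst s).
Proof.
  unfold asymptotic_to, conj_seq. simpl. apply Clim_ext. intros n.
  rewrite Cconj_conj. ring.
Qed.

(** Summable increments make [z] converge, and the lower bound [2 * sigma] on the modulus of
    [z - Cconj z] passes to the limit. *)
Lemma oscillating_jump z E k sigma :
  oscillating z E k sigma ->
  exists tau : C, tau <> 0 /\ Clim (fun n => z n - Cconj (z n)) tau.
Proof.
  intros HO.
  destruct (Clim_of_summable_increments z (osc_dz HO)) as [l Hl].
  assert (H : Clim (fun n => z n - Cconj (z n)) (l - Cconj l))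
    by (apply Clim_minus; [exact Hl | now apply Clim_conj]).
  exists (l - Cconj l). split; [|exact H].
  intros H0. apply Clim_lower_bound with (s := (2 * sigma)%R) in H.
  - rewrite H0, Cmod_0 in H. pose proof (osc_sigma HO). lra.
  - intros n. rewrite Cmod_minus_conj. pose proof (osc_im HO n). lra.
Qed.

(** In [y = (E A - Cconj E B) / (z - Cconj z)] the amplitudes [A], [B] and the denominator may be
    replaced by their limits [lA], [lB] and [tau], which gives the coefficients. *)
Lemma three_term_asymptotics z E k sigma g y :
  oscillating z E k sigma -> three_term z k g y ->
  ex_series (fun n => Cmod (g n)) ->
  exists s, asymptotic_to E y s.
Proof.
  intros HO HT Sg.
  pose proof (oscillating_conj _ _ _ _ HO) as HO'.
  pose proof (three_term_conj _ _ _ _ HT) as HT'.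
  destruct (amplitude_converges _ _ _ _ _ _ HO HT Sg) as [lA HA].
  destruct (amplitude_converges _ _ _ _ _ _ HO' HT' Sg) as [lB HB].
  destruct (oscillating_jump _ _ _ _ HO) as [tau [Htau Hlim]].
  exists (lA / tau, - (lB / tau)). unfold asymptotic_to; simpl.
  pose proof (osc_sigma HO) as Hs.
  assert (Hjump : forall n, (2 * sigma <= Cmod (z n - Cconj (z n)))%R).
  { intros n. rewrite Cmod_minus_conj. pose proof (osc_im HO n). lra. }
  assert (Hnz : forall n, z n - Cconj (z n) <> 0).
  { intros n H. specialize (Hjump n). rewrite H, Cmod_0 in Hjump. lra. }
  (* Subtracting a multiple of [z n - Cconj (z n)] itself leaves exactly the constant [lA / tau]
     after the division by this quantity. *)
  assert (HA0 : Clim (fun n => amplitude z E y n - lA / tau * (z n - Cconj (z n))) 0).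
  { replace (RtoC 0) with (lA - lA / tau * tau) by (field; exact Htau).
    apply Clim_minus; [exact HA | now apply Clim_scal]. }
  assert (HB0 : Clim (fun n => amplitude (conj_seq z) (conj_seq E) y n
                               - lB / tau * (z n - Cconj (z n))) 0).
  { replace (RtoC 0) with (lB - lB / tau * tau) by (field; exact Htau).
    apply Clim_minus; [exact HB | now apply Clim_scal]. }
  assert (HE : forall n, (0 <= n)%nat ->
            (Cmod (E n / (z n - Cconj (z n))) <= / (2 * sigma))%R).
  { intros n _. rewrite Cmod_div by apply Hnz. rewrite (osc_E HO).
    unfold Rdiv. rewrite Rmult_1_l. apply Rinv_le_contravar; [lra | apply Hjump]. }
  assert (HE' : forall n, (0 <= n)%nat ->
            (Cmod (Cconj (E n) / (z n - Cconj (z n))) <= / (2 * sigma))%R).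
  { intros n Hn. rewrite Cmod_div by apply Hnz. rewrite Cmod_conj, <- Cmod_div by apply Hnz.
    now apply HE. }
  pose proof (Clim_bounded_mult_0 _ _ _ O HE HA0) as H1.
  pose proof (Clim_bounded_mult_0 _ _ _ O HE' HB0) as H2.
  replace (RtoC 0) with (0 - 0) by ring.
  refine (Clim_ext _ _ _ _ (Clim_minus _ _ _ _ H1 H2)).
  intros n. pose proof (amplitude_difference z E k sigma y n HO) as HD.
  replace (y n) with ((E n * amplitude z E y n
     - Cconj (E n) * amplitude (conj_seq z) (conj_seq E) y n) / (z n - Cconj (z n))).
  - field. split; [exact Htau | apply Hnz].
  - rewrite HD. field. apply Hnz.
Qed.

(** The amplitude of the pure wave [E] is [z - Cconj z], that of [Cconj E] is zero, and the error is
    only multiplied by numbers of modulus one. Hence the amplitudes determine the coefficients. *)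
Lemma amplitude_lim z E k sigma y s tau :
  oscillating z E k sigma -> Clim (fun n => z n - Cconj (z n)) tau ->
  asymptotic_to E y s -> Clim (amplitude z E y) (fst s * tau).
Proof.
  intros HO Htau Hy.
  set (e := fun n => y n - (fst s * E n + snd s * Cconj (E n))).
  assert (He : Clim e 0) by exact Hy.
  assert (He1 : Clim (fun n => Cconj (E n) * e (S n)) 0).
  { apply Clim_bounded_mult_0 with 1%R O.
    - intros n _. rewrite Cmod_conj, (osc_E HO). apply Rle_refl.
    - apply (Clim_shift e 0 1) in He. revert He. apply Clim_ext.
      intros n. now rewrite Nat.add_1_r. }
  assert (He2 : Clim (fun n => (Cconj (E n) * Cconj (z n)) * e n) 0).
  { apply Clim_bounded_mult_0 with 1%R O; [|exact He].
    intros n _. rewrite Cmod_mult, !Cmod_conj, (osc_E HO), (osc_z HO). lra. }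
  replace (fst s * tau) with (fst s * tau + (0 - 0)) by ring.
  refine (Clim_ext _ _ _ _ (Clim_plus _ _ _ _ (Clim_scal (fst s) _ _ Htau)
                              (Clim_minus _ _ _ _ He1 He2))).
  intros n. unfold amplitude, e.
  rewrite (osc_step HO n), Cmult_conj.
  pose proof (Cconj_unit _ (osc_E HO n)) as HE.
  transitivity (Cconj (E n) * (y (S n) - Cconj (z n) * y n)
     + fst s * (z n - Cconj (z n)) * (1 - E n * Cconj (E n))); [ring|].
  rewrite HE. ring.
Qed.

Lemma amplitude_conj_lim z E k sigma y s tau :
  oscillating z E k sigma -> Clim (fun n => z n - Cconj (z n)) tau ->
  asymptotic_to E y s ->
  Clim (amplitude (conj_seq z) (conj_seq E) y) (- (snd s * tau)).
Proof.
  intros HO Htau Hy.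
  replace (- (snd s * tau)) with (fst (snd s, fst s) * (- tau)) by (simpl; ring).
  apply amplitude_lim with k sigma.
  - now apply oscillating_conj.
  - replace (- tau) with (- (1) * tau) by ring.
    refine (Clim_ext _ _ _ _ (Clim_scal (- (1)) _ _ Htau)).
    intros n. unfold conj_seq. rewrite Cconj_conj. ring.
  - now apply asymptotic_to_conj.
Qed.

Lemma asymptotic_to_unique z E k sigma y s t :
  oscillating z E k sigma ->
  asymptotic_to E y s -> asymptotic_to E y t -> s = t.
Proof.
  intros HO Hs Ht.
  destruct (oscillating_jump _ _ _ _ HO) as [tau [Htau Hlim]].
  assert (H1 : fst s * tau = fst t * tau)
    by (eapply Clim_unique; eapply amplitude_lim; eassumption).
  assert (H2 : - (snd s * tau) = - (snd t * tau))
    by (eapply Clim_unique; eapply amplitude_conj_lim; eassumption).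
  apply injective_projections.
  - replace (fst s) with (fst s * tau / tau) by (field; exact Htau).
    rewrite H1. field; exact Htau.
  - replace (snd s) with (- (- (snd s * tau)) / tau) by (field; exact Htau).
    rewrite H2. field; exact Htau.
Qed.

(** The bracket times [z - Cconj z] is the determinant of the amplitudes of [y] and [w], with limit
    [tau * tau * (fst s * snd t - snd s * fst t)]. The quotient of [c] and [z - Cconj z] is bounded
    above and below, so a vanishing limit carries over in both directions. *)
Lemma weighted_bracket_lim_0 z E k sigma (c : nat -> R) (m K : R) y w s t L :
  oscillating z E k sigma -> (0 < m)%R ->
  (forall n, m <= c n <= K)%R ->
  asymptotic_to E y s -> asymptotic_to E w t ->
  Clim (fun n => c n * (y (S n) * w n - y n * w (S n))) L ->
  (L = 0 <-> fst s * snd t = snd s * fst t).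
Proof.
  intros HO Hm Hc Hy Hw HL.
  destruct (oscillating_jump _ _ _ _ HO) as [tau [Htau Hlim]].
  pose proof (osc_sigma HO) as Hs.
  set (A := amplitude z E). set (B := amplitude (conj_seq z) (conj_seq E)).
  set (br := fun n => y (S n) * w n - y n * w (S n)).
  assert (Hbr : forall n, A w n * B y n - A y n * B w n = (z n - Cconj (z n)) * br n).
  { intros n. unfold A, B, amplitude, conj_seq, br. rewrite !Cconj_conj.
    transitivity (E n * Cconj (E n)
      * ((z n - Cconj (z n)) * (y (S n) * w n - y n * w (S n)))); [ring|].
    rewrite (Cconj_unit _ (osc_E HO n)). ring. }
  assert (HAB : Clim (fun n => A w n * B y n - A y n * B w n)
                     (tau * tau * (fst s * snd t - snd s * fst t))).
  { replace (tau * tau * (fst s * snd t - snd s * fst t))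
      with ((fst t * tau) * (- (snd s * tau)) - (fst s * tau) * (- (snd t * tau))) by ring.
    apply Clim_minus; apply Clim_mult;
      (eapply amplitude_lim || eapply amplitude_conj_lim); eassumption. }
  assert (Hjump : forall n, (2 * sigma <= Cmod (z n - Cconj (z n)) <= 2)%R).
  { intros n. split.
    - rewrite Cmod_minus_conj. pose proof (osc_im HO n). lra.
    - unfold Cminus. eapply Rle_trans; [apply Cmod_triangle|].
      rewrite Cmod_opp, Cmod_conj, (osc_z HO). lra. }
  assert (Hnz : forall n, z n - Cconj (z n) <> 0).
  { intros n H. specialize (Hjump n). rewrite H, Cmod_0 in Hjump. lra. }
  assert (Hcnz : forall n, RtoC (c n) <> 0).
  { intros n H. injection H as H. specialize (Hc n). lra. }
  split.
  - intros ->.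
    assert (H : Clim (fun n => A w n * B y n - A y n * B w n) 0).
    { refine (Clim_ext _ _ _ _ (Clim_bounded_mult_0
        (fun n => (z n - Cconj (z n)) / c n) _ (2 / m)%R O _ HL)).
      - intros n. rewrite Hbr. unfold br. field. apply Hcnz.
      - intros n _. rewrite Cmod_div by apply Hcnz.
        specialize (Hc n). rewrite Cmod_R, Rabs_pos_eq by lra.
        specialize (Hjump n).
        apply Rmult_le_compat; [lra | left; apply Rinv_0_lt_compat; lra | lra |].
        apply Rinv_le_contravar; lra. }
    pose proof (Clim_unique _ _ _ HAB H) as H0.
    replace (fst s * snd t) with ((fst s * snd t - snd s * fst t) + snd s * fst t) by ring.
    replace (fst s * snd t - snd s * fst t)
      with (tau * tau * (fst s * snd t - snd s * fst t) / (tau * tau))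
      by (field; exact Htau).
    rewrite H0. field; exact Htau.
  - intros Heq. rewrite Heq in HAB.
    replace (tau * tau * (snd s * fst t - snd s * fst t)) with (RtoC 0) in HAB by ring.
    apply (Clim_unique _ _ _ HL).
    refine (Clim_ext _ _ _ _ (Clim_bounded_mult_0
        (fun n => c n / (z n - Cconj (z n))) _ (K / (2 * sigma))%R O _ HAB)).
    + intros n. rewrite Hbr. unfold br. field. apply Hnz.
    + intros n _. rewrite Cmod_div by apply Hnz.
      specialize (Hc n). rewrite Cmod_R, Rabs_pos_eq by lra.
      specialize (Hjump n).
      apply Rmult_le_compat; [lra | left; apply Rinv_0_lt_compat; lra | lra |].
      apply Rinv_le_contravar; lra.
Qed.

(** * Asymptotics of solutions of the Jacobi equation *)

Lemma expi_unit (t : R) : Cmod (expi t) = 1%R.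
Proof.
  unfold Cmod, expi; simpl. transitivity (sqrt 1); [|exact sqrt_1].
  f_equal. pose proof (sin2_cos2 t) as H. unfold Rsqr in H. lra.
Qed.

Lemma expi_plus (s t : R) : expi (s + t) = expi s * expi t.
Proof.
  unfold expi. rewrite cos_plus, sin_plus.
  apply injective_projections; simpl; ring.
Qed.

Lemma expi_opp (t : R) : expi (- t) = Cconj (expi t).
Proof. unfold expi, Cconj; simpl. now rewrite cos_neg, sin_neg. Qed.

(** The cosines differ by [x - y]. For the sines [p] and [q], the identity [p^2 - q^2 = y^2 - x^2]
    with [p + q >= 2 s] gives the factor [/ s]; the bound [s] excludes the endpoints, where [acos]
    is not Lipschitz. *)
Lemma expi_acos_lipschitz (x y s : R) :
  (Rabs x <= 1)%R -> (Rabs y <= 1)%R -> (0 < s)%R ->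
  (s <= sin (acos x))%R -> (s <= sin (acos y))%R ->
  (Cmod (expi (acos x) - expi (acos y)) <= (1 + / s) * Rabs (x - y))%R.
Proof.
  intros Hx Hy Hs Hsx Hsy.
  apply Rabs_le_between in Hx. apply Rabs_le_between in Hy.
  eapply Rle_trans; [apply Cmod_le_Rabs|].
  unfold expi; simpl. rewrite !cos_acos by lra.
  change (x + - y)%R with (x - y)%R.
  rewrite Rmult_plus_distr_r, Rmult_1_l. apply Rplus_le_compat_l.
  apply Rmult_le_reg_l with s; [exact Hs|].
  rewrite <- Rmult_assoc, Rinv_r, Rmult_1_l by lra.
  pose proof (sin2_cos2 (acos x)) as Ex. pose proof (sin2_cos2 (acos y)) as Ey.
  rewrite cos_acos in Ex, Ey by lra. unfold Rsqr in Ex, Ey.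
  set (p := sin (acos x)) in *. set (q := sin (acos y)) in *.
  change (p + - q)%R with (p - q)%R.
  assert (H : ((p + q) * Rabs (p - q) = Rabs (x + y) * Rabs (x - y))%R).
  { rewrite <- (Rabs_pos_eq (p + q)) by lra. rewrite <- !Rabs_mult.
    rewrite <- (Rabs_Ropp ((x + y) * (x - y))). f_equal. lra. }
  assert (Rabs (x + y) <= 2)%R by (apply Rabs_le; lra).
  pose proof (Rabs_pos (x - y)). pose proof (Rabs_pos (p - q)).
  assert ((p + q) * Rabs (p - q) <= 2 * Rabs (x - y))%R.
  { rewrite H. now apply Rmult_le_compat_r. }
  nra.
Qed.

(* Meant for [c n = sqrt (a_n / a_{n+1})]: the quotient of successive ratios is [k_{n+1}]. *)
Lemma telescoping_ratio_bounds (c k : nat -> R) :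
  (forall n, 0 < c n)%R -> (forall n, c (S n) = k n * c n)%R ->
  (forall n, Rabs (k n - 1) <= 1 / 2)%R -> ex_series (fun n => Rabs (k n - 1)) ->
  exists m K, (0 < m)%R /\ forall n, (m <= c n <= K)%R.
Proof.
  intros Hc Hrec Hk Sk.
  assert (Hkb : forall n, (1 - Rabs (k n - 1) <= k n <= 1 + Rabs (k n - 1))%R).
  { intros n. pose proof (Rle_abs (k n - 1)). pose proof (Rle_abs (- (k n - 1))) as H1.
    rewrite Rabs_Ropp in H1. lra. }
  destruct (discrete_gronwall c (fun n => Rabs (k n - 1)) (fun n => Rabs (k n - 1)))
    as [K [HK HcK]].
  - intros n; left; apply Hc.
  - intros n; apply Rabs_pos.
  - intros n; apply Rabs_pos.
  - exact Sk.
  - exact Sk.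
  - intros n. rewrite Hrec. specialize (Hc n). specialize (Hkb n).
    pose proof (Rabs_pos (k n - 1)). nra.
  (* The lower bound on [c] is an upper bound on [/ c]; it uses [/ k <= 1 + 2 |k - 1|], valid
     because [|k - 1| <= 1 / 2]. *)
  - destruct (discrete_gronwall (fun n => / c n)%R (fun n => 2 * Rabs (k n - 1))%R
                (fun n => Rabs (k n - 1))) as [K' [HK' HcK']].
    + intros n; left; apply Rinv_0_lt_compat, Hc.
    + intros n; pose proof (Rabs_pos (k n - 1)); lra.
    + intros n; apply Rabs_pos.
    + now apply ex_series_Rscal.
    + exact Sk.
    + intros n. rewrite Hrec. specialize (Hc n). specialize (Hkb n). specialize (Hk n).
      pose proof (Rabs_pos (k n - 1)) as Hp.
      assert (Hic : (0 < / c n)%R) by (apply Rinv_0_lt_compat, Hc).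
      rewrite Rinv_mult.
      assert (/ k n <= 1 + 2 * Rabs (k n - 1))%R.
      { apply Rmult_le_reg_l with (k n); [lra|]. rewrite Rinv_r by lra. nra. }
      assert (/ k n * / c n <= (1 + 2 * Rabs (k n - 1)) * / c n)%R
        by (apply Rmult_le_compat_r; lra).
      lra.
    + exists (/ K')%R, K. split; [now apply Rinv_0_lt_compat|].
      intros n. split; [|apply HcK].
      rewrite <- (Rinv_inv (c n)). apply Rinv_le_contravar; [apply Rinv_0_lt_compat, Hc | apply HcK'].
Qed.

(** The situation beyond an index [N] from which [beta] lies in a compact part of (-1, 1), so that
    [phi] grows by [theta] at each step. The index of [kappa] is [S (n + N)] because the recurrence
    for [y n], [y (S n)], [y (S (S n))] is centred at [S n]. *)
Record regime (am1 : R) (a b : nat -> R) (N : nat) (sigma m K : R) : Prop := {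
  reg_a : forall n, (0 < a n)%R;
  reg_sum : ex_series (fun n => (/ a n)%R);
  reg_osc : oscillating (fun n => expi (theta am1 a b (n + N)))
              (fun n => expi (phi am1 a b (n + N)))
              (fun n => kappa am1 a (S (n + N))) sigma;
  reg_beta : forall n, expi (theta am1 a b (n + N)) + Cconj (expi (theta am1 a b (n + N)))
                       = RtoC (2 * beta am1 a b (n + N));
  reg_m : (0 < m)%R;
  reg_ratio : forall n, (m <= sqrt (a (n + N)%nat) / sqrt (a (S (n + N))) <= K)%R
}.

Arguments reg_a {am1 a b N sigma m K} _.
Arguments reg_sum {am1 a b N sigma m K} _.
Arguments reg_osc {am1 a b N sigma m K} _.
Arguments reg_beta {am1 a b N sigma m K} _.
Arguments reg_m {am1 a b N sigma m K} _.
Arguments reg_ratio {am1 a b N sigma m K} _.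

Lemma kappa_ratio (am1 : R) (a : nat -> R) (n : nat) :
  (forall n, 0 < a n)%R ->
  (sqrt (a (S n)) / sqrt (a (S (S n))) = kappa am1 a (S n) * (sqrt (a n) / sqrt (a (S n))))%R.
Proof.
  intros ha. unfold kappa; simpl.
  rewrite sqrt_mult by (left; apply ha).
  pose proof (sqrt_lt_R0 _ (ha n)). pose proof (sqrt_lt_R0 _ (ha (S n))).
  pose proof (sqrt_lt_R0 _ (ha (S (S n)))).
  rewrite <- (sqrt_sqrt (a (S n))) at 2 by (left; apply ha). field. lra.
Qed.

Lemma regime_exists (a b : nat -> R) (am1 : R) (beta_inf : R)
  (ha : forall n, (0 < a n)%R)
  (hsum : ex_series (fun n => (/ a n)%R))
  (hbeta : is_lim_seq (beta am1 a b) beta_inf)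
  (hbeta_inf : (Rabs beta_inf < 1)%R)
  (hk : ex_series (fun n => Rabs (kappa am1 a n - 1)))
  (hdbeta : ex_series (fun n => Rabs (beta am1 a b (S n) - beta am1 a b n))) :
  exists N sigma m K, regime am1 a b N sigma m K.
Proof.
  (* The midpoint between [Rabs beta_inf] and 1 eventually bounds [Rabs (beta n)]; then
     [sqrt (1 - rho * rho)] bounds the sine of [theta] from below. *)
  set (rho := ((1 + Rabs beta_inf) / 2)%R).
  pose proof (Rabs_pos beta_inf) as Hb0.
  assert (Hev : eventually (fun n => Rabs (beta am1 a b n) <= rho)%R).
  { apply is_lim_seq_spec in hbeta.
    assert (He : (0 < (1 - Rabs beta_inf) / 2)%R) by lra.
    destruct (hbeta (mkposreal _ He)) as [N HN]. exists N. intros n Hn.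
    specialize (HN n Hn). simpl in HN.
    pose proof (Rabs_triang (beta am1 a b n - beta_inf) beta_inf) as HT.
    replace (beta am1 a b n - beta_inf + beta_inf)%R with (beta am1 a b n) in HT by ring.
    unfold rho. lra. }
  assert (Hevk : eventually (fun n => Rabs (kappa am1 a n - 1) <= 1 / 2)%R).
  { pose proof (ex_series_lim_0 _ hk) as H. apply is_lim_seq_spec in H.
    assert (He : (0 < 1 / 2)%R) by lra.
    destruct (H (mkposreal _ He)) as [N HN]. exists N. intros n Hn.
    specialize (HN n Hn). simpl in HN.
    rewrite Rminus_0_r, Rabs_pos_eq in HN by apply Rabs_pos. lra. }
  destruct Hev as [N1 HN1]. destruct Hevk as [N2 HN2].
  set (N := Nat.max N1 N2).
  assert (Hrho : (rho < 1)%R) by (unfold rho; lra).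
  assert (Hbeta : forall n, (Rabs (beta am1 a b (n + N)) <= rho)%R)
    by (intros n; apply HN1; lia).
  assert (Hkap : forall n, (Rabs (kappa am1 a (S (n + N)) - 1) <= 1 / 2)%R)
    by (intros n; apply HN2; lia).
  set (sigma := sqrt (1 - rho * rho)).
  assert (Hrho2 : (0 <= rho)%R) by (unfold rho; lra).
  assert (Hsigma : (0 < sigma)%R) by (apply sqrt_lt_R0; nra).
  assert (Hsin : forall n, (sigma <= sin (theta am1 a b (n + N)))%R).
  { intros n. specialize (Hbeta n). apply Rabs_le_between in Hbeta.
    unfold theta. rewrite sin_acos by lra.
    apply sqrt_le_1_alt. unfold Rsqr. nra. }
  assert (Sk : ex_series (fun n => Rabs (kappa am1 a (S (n + N)) - 1))).
  { apply (ex_series_shift _ (S N)) in hk. revert hk. apply ex_series_ext.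
    intros n. do 3 f_equal. lia. }
  destruct (telescoping_ratio_bounds
              (fun n => sqrt (a (n + N)%nat) / sqrt (a (S (n + N))))%R
              (fun n => kappa am1 a (S (n + N)))) as [m [K [Hm HK]]].
  { intros n. apply Rdiv_lt_0_compat; apply sqrt_lt_R0, ha. }
  { intros n. apply kappa_ratio, ha. }
  { exact Hkap. }
  { exact Sk. }
  exists N, sigma, m, K. split; trivial.
  - split; trivial.
    + intros n; apply expi_unit.
    + intros n; apply expi_unit.
    + intros n. change (S n + N)%nat with (S (n + N)). simpl phi.
      destruct (Rle_dec _ 1) as [_|H].
      * rewrite expi_plus. apply Cmult_comm.
      * exfalso. apply H. specialize (Hbeta n). lra.
    + intros n. simpl. specialize (Hsin n). rewrite Rabs_pos_eq; lra.
    + apply ex_series_dominated with (fun n => (1 + / sigma) *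
        Rabs (beta am1 a b (S (n + N)) - beta am1 a b (n + N)))%R.
      * intros n. rewrite Rabs_pos_eq by apply Cmod_ge_0.
        apply expi_acos_lipschitz; trivial.
        -- specialize (Hbeta (S n)). simpl in Hbeta. lra.
        -- specialize (Hbeta n). lra.
        -- apply (Hsin (S n)).
        -- apply Hsin.
      * apply ex_series_Rscal.
        apply (ex_series_shift (fun n => Rabs (beta am1 a b (S n) - beta am1 a b n)) N hdbeta).
  - intros n. specialize (Hbeta n). apply Rabs_le_between in Hbeta.
    unfold expi, theta. rewrite cos_acos by lra.
    apply injective_projections; simpl; ring.
Qed.

Definition weighted (a : nat -> R) (u : cseq) : cseq := fun n => sqrt (a n) * u n.

Lemma RtoC_sqrt_neq_0 (a : nat -> R) (n : nat) :
  (forall n, 0 < a n)%R -> RtoC (sqrt (a n)) <> 0.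
Proof. intros ha H. injection H as H. pose proof (sqrt_lt_R0 _ (ha n)). lra. Qed.

Lemma asymptotics_weighted am1 a b u s :
  (forall n, 0 < a n)%R ->
  (asymptotics am1 a b u s
   <-> asymptotic_to (fun n => expi (phi am1 a b n)) (weighted a u) s).
Proof.
  intros ha. unfold asymptotic_to, weighted. split.
  - intros [e [He Hu]].
    apply Clim_ext with e.
    + intros n. rewrite Hu, expi_opp.
      rewrite RtoC_inv by (apply Rgt_not_eq, sqrt_lt_R0, ha).
      field. now apply RtoC_sqrt_neq_0.
    + revert He. apply is_lim_seq_ext. intros n. f_equal. ring.
  - intros H.
    exists (fun n => sqrt (a n) * u n
      - (fst s * expi (phi am1 a b n) + snd s * Cconj (expi (phi am1 a b n)))).
    split.
    + revert H. unfold Clim. apply is_lim_seq_ext. intros n. f_equal. ring.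
    + intros n. rewrite expi_opp.
      rewrite RtoC_inv by (apply Rgt_not_eq, sqrt_lt_R0, ha).
      field. now apply RtoC_sqrt_neq_0.
Qed.

Lemma asymptotics_tail am1 a b u s (N : nat) :
  (forall n, 0 < a n)%R ->
  (asymptotics am1 a b u s
   <-> asymptotic_to (fun n => expi (phi am1 a b (n + N)))
         (fun n => weighted a u (n + N)%nat) s).
Proof.
  intros ha. rewrite asymptotics_weighted by exact ha.
  unfold asymptotic_to. rewrite (Clim_shift _ 0 N). reflexivity.
Qed.

(** With [p = n + N], this is row [S p] of the Jacobi expression divided by [sqrt (a p)]. *)
Lemma weighted_three_term am1 a b N sigma m K u :
  regime am1 a b N sigma m K ->
  three_term (fun n => expi (theta am1 a b (n + N)))
    (fun n => kappa am1 a (S (n + N)))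
    (fun n => jacobi a b u (S (n + N)) / sqrt (a (n + N)%nat))
    (fun n => weighted a u (n + N)%nat).
Proof.
  intros HR n.
  pose proof (reg_a HR) as ha.
  rewrite (reg_beta HR (S n)).
  change (S n + N)%nat with (S (n + N)). change (S (S n) + N)%nat with (S (S (n + N))).
  set (p := (n + N)%nat). unfold beta, kappa, weighted; simpl.
  pose proof (sqrt_lt_R0 _ (ha p)) as H0. pose proof (sqrt_lt_R0 _ (ha (S p))) as H1.
  pose proof (sqrt_lt_R0 _ (ha (S (S p)))) as H2.
  rewrite !sqrt_mult by (left; apply ha).
  assert (E0 : RtoC (a p) = sqrt (a p) * sqrt (a p))
    by (rewrite <- RtoC_mult, sqrt_sqrt; [reflexivity | left; apply ha]).
  assert (E1 : RtoC (a (S p)) = sqrt (a (S p)) * sqrt (a (S p)))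
    by (rewrite <- RtoC_mult, sqrt_sqrt; [reflexivity | left; apply ha]).
  replace (2 * - (b (S p) / (2 * (sqrt (a p) * sqrt (a (S p))))))%R
    with (- (b (S p) / (sqrt (a p) * sqrt (a (S p)))))%R by (field; lra).
  rewrite RtoC_opp, !RtoC_div by (apply Rgt_not_eq; now apply Rmult_lt_0_compat).
  rewrite !RtoC_mult, E0, E1.
  field. repeat split; now apply RtoC_sqrt_neq_0.
Qed.

(** The summand is a product [x * r] with [x] and [r] square summable, [r^2] being [/ a]; it is at
    most [x^2 + r^2]. *)
Lemma l2_tail_summable a b N u :
  (forall n, 0 < a n)%R -> ex_series (fun n => (/ a n)%R) ->
  l2 (jacobi a b u) ->
  ex_series (fun n => Cmod (jacobi a b u (S (n + N)) / sqrt (a (n + N)%nat))).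
Proof.
  intros ha hsum Hl.
  apply ex_series_dominated with
    (fun n => Cmod (jacobi a b u (S (n + N))) ^ 2 + / a (n + N)%nat)%R.
  - intros n. rewrite Rabs_pos_eq by apply Cmod_ge_0.
    rewrite Cmod_div by now apply RtoC_sqrt_neq_0.
    pose proof (sqrt_lt_R0 _ (ha (n + N)%nat)) as H.
    rewrite Cmod_R, Rabs_pos_eq by lra.
    rewrite <- (sqrt_sqrt (a (n + N)%nat)) at 2 by (left; apply ha).
    rewrite Rinv_mult. unfold Rdiv.
    set (x := Cmod _). set (r := (/ sqrt (a (n + N)%nat))%R). nra.
  - apply ex_series_Rplus.
    + apply (ex_series_shift _ (S N)) in Hl. revert Hl. apply ex_series_ext.
      intros n. do 3 f_equal. lia.
    + apply (ex_series_shift (fun n => / a n)%R), hsum.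
Qed.

Lemma asymptotics_exists am1 a b N sigma m K u :
  regime am1 a b N sigma m K -> l2 (jacobi a b u) ->
  exists s, asymptotics am1 a b u s.
Proof.
  intros HR Hl.
  pose proof (reg_a HR) as ha.
  destruct (three_term_asymptotics _ _ _ _ _ _ (reg_osc HR)
              (weighted_three_term _ _ _ _ _ _ _ u HR)) as [s Hs].
  - apply l2_tail_summable; [exact ha | apply (reg_sum HR) | exact Hl].
  - exists s. apply (asymptotics_tail _ _ _ _ _ N ha). exact Hs.
Qed.

(** The weighted sequence is bounded, so [Cmod (u n) ^ 2] is at most a constant times [/ a n] on the
    tail. This is the limit circle case: all solutions are square summable. *)
Lemma l2_of_l2_jacobi am1 a b N sigma m K u :
  regime am1 a b N sigma m K -> l2 (jacobi a b u) -> l2 u.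
Proof.
  intros HR Hl.
  pose proof (reg_a HR) as ha.
  pose proof (reg_sum HR) as hsum.
  destruct (three_term_bounded _ _ _ _ _ _ (reg_osc HR)
              (weighted_three_term _ _ _ _ _ _ _ u HR)) as [B [HB HyB]].
  - now apply l2_tail_summable.
  - unfold l2. apply (ex_series_incr_n _ N).
    apply ex_series_dominated with (fun n => B ^ 2 * / a (n + N)%nat)%R.
    + intros n. rewrite Rabs_pos_eq by (apply pow_le, Cmod_ge_0).
      rewrite (Nat.add_comm N n). specialize (HyB n). unfold weighted in HyB.
      rewrite Cmod_mult, Cmod_R, Rabs_pos_eq in HyB by apply sqrt_pos.
      apply Rmult_le_reg_l with (a (n + N)%nat); [apply ha|].
      replace (a (n + N)%nat * (B ^ 2 * / a (n + N)%nat))%R with (B ^ 2)%R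
        by (field; apply Rgt_not_eq, ha).
      rewrite <- (sqrt_sqrt (a (n + N)%nat)) by (left; apply ha).
      replace (sqrt (a (n + N)%nat) * sqrt (a (n + N)%nat) * Cmod (u (n + N)%nat) ^ 2)%R
        with ((sqrt (a (n + N)%nat) * Cmod (u (n + N)%nat)) ^ 2)%R by ring.
      apply pow_incr. split; [|exact HyB].
      apply Rmult_le_pos; [apply sqrt_pos | apply Cmod_ge_0].
    + apply ex_series_Rscal, (ex_series_shift (fun n => / a n)%R), hsum.
Qed.

Lemma asymptotics_unique am1 a b N sigma m K u s t :
  regime am1 a b N sigma m K ->
  asymptotics am1 a b u s -> asymptotics am1 a b u t -> s = t.
Proof.
  intros HR Hs Ht. pose proof (reg_a HR) as ha.
  apply (asymptotics_tail _ _ _ _ _ N ha) in Hs.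
  apply (asymptotics_tail _ _ _ _ _ N ha) in Ht.
  exact (asymptotic_to_unique _ _ _ _ _ _ _ (reg_osc HR) Hs Ht).
Qed.

(** By uniqueness of the asymptotics the choice made in [s_pair] is forced. *)
Lemma s_pair_eq am1 a b N sigma m K u s :
  regime am1 a b N sigma m K ->
  asymptotics am1 a b u s -> s_pair am1 a b u = s.
Proof.
  intros HR Hs. apply (asymptotics_unique _ _ _ _ _ _ _ u _ _ HR); [|exact Hs].
  unfold s_pair. apply epsilon_spec. now exists s.
Qed.

Arguments s_pair_eq {am1 a b N sigma m K u s} _.

Lemma asymptotics_linear am1 a b u v s t (c : C) :
  (forall n, 0 < a n)%R ->
  asymptotics am1 a b u s -> asymptotics am1 a b v t ->
  asymptotics am1 a b (fun n => c * u n + v n) (c * fst s + fst t, c * snd s + snd t).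
Proof.
  intros ha Hs Ht. apply asymptotics_weighted in Hs, Ht; trivial.
  apply asymptotics_weighted; trivial.
  unfold asymptotic_to, weighted in *. simpl.
  replace (RtoC 0) with (c * 0 + 0) by ring.
  refine (Clim_ext _ _ _ _ (Clim_plus _ _ _ _ (Clim_scal c _ _ Hs) Ht)).
  intros n. simpl. ring.
Qed.

(** Conjugation exchanges the two waves, hence also the two coefficients. *)
Lemma asymptotics_conj am1 a b v t :
  (forall n, 0 < a n)%R -> asymptotics am1 a b v t ->
  asymptotics am1 a b (conj_seq v) (Cconj (snd t), Cconj (fst t)).
Proof.
  intros ha Ht. apply asymptotics_weighted in Ht; trivial.
  apply asymptotics_weighted; trivial.
  unfold asymptotic_to, weighted, conj_seq in *. simpl.
  replace (RtoC 0) with (Cconj 0) by (apply injective_projections; simpl; ring).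
  refine (Clim_ext _ _ _ _ (Clim_conj _ _ Ht)).
  intros n.
  rewrite Cminus_conj, Cplus_conj, !Cmult_conj, Cconj_conj.
  replace (Cconj (RtoC (sqrt (a n)))) with (RtoC (sqrt (a n)))
    by (apply injective_projections; simpl; ring).
  ring.
Qed.

Lemma asymptotics_finite am1 a b (u : cseq) (N : nat) :
  (forall n, 0 < a n)%R -> (forall n, (N <= n)%nat -> u n = 0) ->
  asymptotics am1 a b u (RtoC 0, RtoC 0).
Proof.
  intros ha Hu. apply asymptotics_weighted; trivial.
  unfold asymptotic_to, weighted; simpl.
  apply Clim_ext_loc with (fun _ => RtoC 0) N; [|apply Clim_const].
  intros n Hn. rewrite (Hu n Hn). ring.
Qed.

(** * Green's formula and self-adjoint restrictions *)

Lemma ex_series_finite (f : nat -> R) (N : nat) :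
  (forall n, (N <= n)%nat -> f n = 0%R) -> ex_series f.
Proof.
  intros H. apply (ex_series_incr_n f N).
  apply ex_series_ext with (fun n => 0 * (1 / 2) ^ n)%R.
  - intros n. rewrite H by lia. apply Rmult_0_l.
  - apply ex_series_Rscal, ex_series_geom. rewrite Rabs_pos_eq; lra.
Qed.

Lemma l2_finite (u : cseq) (N : nat) : (forall n, (N <= n)%nat -> u n = 0) -> l2 u.
Proof.
  intros H. apply ex_series_finite with N. intros n Hn. rewrite (H n Hn), Cmod_0. ring.
Qed.

Lemma l2_linear (c : C) (u v : cseq) : l2 u -> l2 v -> l2 (fun n => c * u n + v n).
Proof.
  intros Hu Hv. unfold l2 in *.
  apply ex_series_dominated with
    (fun n => 2 * Cmod c ^ 2 * Cmod (u n) ^ 2 + 2 * Cmod (v n) ^ 2)%R.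
  - intros n. rewrite Rabs_pos_eq by (apply pow_le, Cmod_ge_0).
    pose proof (Cmod_triangle (c * u n) (v n)) as HT. rewrite Cmod_mult in HT.
    pose proof (Cmod_ge_0 (c * u n + v n)).
    set (p := (Cmod c * Cmod (u n))%R) in *. set (q := Cmod (v n)) in *.
    replace (2 * Cmod c ^ 2 * Cmod (u n) ^ 2)%R with (2 * p ^ 2)%R by (unfold p; ring).
    apply Rle_trans with ((p + q) ^ 2)%R; [now apply pow_incr|].
    pose proof (pow2_ge_0 (p - q)). lra.
  - apply ex_series_Rplus; now apply ex_series_Rscal.
Qed.

Lemma l2_product_summable (u v : cseq) :
  l2 u -> l2 v -> ex_series (fun n => Cmod (u n * Cconj (v n))).
Proof.
  intros Hu Hv.
  apply ex_series_dominated with (fun n => Cmod (u n) ^ 2 + Cmod (v n) ^ 2)%R.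
  - intros n. rewrite Rabs_pos_eq by apply Cmod_ge_0.
    rewrite Cmod_mult, Cmod_conj. nra.
  - now apply ex_series_Rplus.
Qed.

Lemma finite_product_summable (u v : cseq) (N : nat) :
  (forall n, (N <= n)%nat -> u n = 0) -> ex_series (fun n => Cmod (u n * v n)).
Proof.
  intros H. apply ex_series_finite with N. intros n Hn.
  rewrite (H n Hn), Cmult_0_l. apply Cmod_0.
Qed.

Lemma sum_n_Cminus (f g : nat -> C) (n : nat) :
  sum_n (fun k => f k - g k) n = sum_n f n - sum_n g n.
Proof.
  induction n as [|n IH]; rewrite ?sum_O, ?sum_Sn; [reflexivity|].
  rewrite IH. change plus with Cplus. refine (_ : @eq C _ _). ring.
Qed.

(** Bilinear; the scalar product is reached by inserting [conj_seq v] as second argument. *)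
Definition wronskian (a : nat -> R) (u v : cseq) (n : nat) : C :=
  a n * (u (S n) * v n - u n * v (S n)).

Lemma wronskian_step a b u v (n : nat) :
  jacobi a b u (S n) * v (S n) - u (S n) * jacobi a b v (S n)
  = wronskian a u v (S n) - wronskian a u v n.
Proof. unfold wronskian; simpl. ring. Qed.

(** The [b] terms cancel and the rest telescopes. Row 0 has no left neighbour, so only the Wronskian
    at the right end remains. *)
Lemma green_sum a b u v (n : nat) :
  sum_n (fun k => jacobi a b u k * v k - u k * jacobi a b v k) n = wronskian a u v n.
Proof.
  induction n as [|n IH].
  - rewrite sum_O. refine (_ : @eq C _ _). unfold wronskian; simpl. ring.
  - rewrite sum_Sn, IH, wronskian_step. refine (_ : @eq C _ _).
    change plus with Cplus. ring.
Qed.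

Lemma jacobi_conj a b u (n : nat) :
  jacobi a b (conj_seq u) n = Cconj (jacobi a b u n).
Proof.
  assert (HR : forall x : R, Cconj (RtoC x) = RtoC x)
    by (intros x; apply injective_projections; simpl; ring).
  unfold conj_seq. destruct n; simpl; now rewrite !Cplus_conj, !Cmult_conj, !HR.
Qed.

Lemma jacobi_linear a b (c : C) u v :
  jacobi a b (fun n => c * u n + v n) = (fun n => c * jacobi a b u n + jacobi a b v n).
Proof. apply functional_extensionality. intros [|n]; simpl; ring. Qed.

Lemma jacobi_finite a b (u : cseq) (N : nat) :
  (forall n, (N <= n)%nat -> u n = 0) ->
  forall n, (S N <= n)%nat -> jacobi a b u n = 0.
Proof.
  intros H [|n] Hn; [lia|]. simpl. rewrite !H by lia. ring.
Qed.

(** Assuming summability of the two products covers both square summable pairs and a finitely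
    supported [u] against an arbitrary [v]. *)
Lemma green_lim a b u v :
  ex_series (fun n => Cmod (jacobi a b u n * Cconj (v n))) ->
  ex_series (fun n => Cmod (u n * Cconj (jacobi a b v n))) ->
  Clim (wronskian a u (conj_seq v))
       (inner (jacobi a b u) v - inner u (jacobi a b v)).
Proof.
  intros H1 H2.
  refine (Clim_ext _ _ _ _ (Clim_minus _ _ _ _ (Clim_sum_n _ H1) (Clim_sum_n _ H2))).
  intros n. rewrite <- sum_n_Cminus, <- (green_sum a b). apply sum_n_ext.
  intros k. now rewrite jacobi_conj.
Qed.

Lemma green_finite a b (u v : cseq) (N : nat) :
  (forall n, (N <= n)%nat -> u n = 0) ->
  inner (jacobi a b u) v = inner u (jacobi a b v).
Proof.
  intros Hu.
  assert (H : Clim (wronskian a u (conj_seq v))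
                (inner (jacobi a b u) v - inner u (jacobi a b v))).
  { apply green_lim.
    - apply finite_product_summable with (S N). now apply jacobi_finite.
    - apply finite_product_summable with N. exact Hu. }
  assert (H0 : Clim (wronskian a u (conj_seq v)) 0).
  { apply Clim_ext_loc with (fun _ => RtoC 0) N; [|apply Clim_const].
    intros n Hn. unfold wronskian. rewrite !Hu by lia. ring. }
  pose proof (Clim_unique _ _ _ H H0) as E.
  replace (inner (jacobi a b u) v)
    with ((inner (jacobi a b u) v - inner u (jacobi a b v)) + inner u (jacobi a b v)) by ring.
  rewrite E. ring.
Qed.

(** * Adjoints of extensions of the minimal operator *)

Definition delta (n : nat) : cseq := fun k => if Nat.eqb k n then RtoC 1 else RtoC 0.

Lemma delta_finite (n k : nat) : (S n <= k)%nat -> delta n k = 0.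
Proof. intros H. unfold delta. destruct (Nat.eqb_spec k n); [lia | reflexivity]. Qed.

Lemma inner_delta (n : nat) (w : cseq) : inner (delta n) w = Cconj (w n).
Proof.
  assert (H : forall k, sum_n (fun j => delta n j * Cconj (w j)) k
                        = if Nat.leb n k then Cconj (w n) else RtoC 0).
  { induction k as [|k IH].
    - rewrite sum_O. refine (_ : @eq C _ _). unfold delta. destruct n; simpl; ring.
    - rewrite sum_Sn, IH. refine (_ : @eq C _ _).
      change plus with Cplus. unfold delta.
      destruct (Nat.eqb_spec (S k) n), (Nat.leb_spec n k), (Nat.leb_spec n (S k));
        try lia; subst; ring. }
  apply (Clim_unique (sum_n (fun j => delta n j * Cconj (w j)))).
  - apply Clim_sum_n, finite_product_summable with (S n). apply delta_finite.
  - apply Clim_ext_loc with (fun _ => Cconj (w n)) n; [|apply Clim_const].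
    intros k Hk. rewrite H. destruct (Nat.leb_spec n k); [reflexivity | lia].
Qed.

(** Testing the adjoint relation on [delta n] and moving the Jacobi expression to [v] by Green's
    formula reads off [w n]. The choice made in [adjoint] is thereby forced. *)
Lemma adjoint_rel_jacobi a b (A : operator) v w :
  op_incl (Jmin a b) A -> adjoint_rel A v w -> w = jacobi a b v.
Proof.
  intros HA [_ [_ H]]. apply functional_extensionality. intros n.
  destruct (HA (delta n)) as [Hd Hf]; [exists (S n); apply delta_finite|].
  specialize (H _ Hd). rewrite <- Hf in H. simpl in H.
  rewrite (green_finite a b (delta n) v (S n) (delta_finite n)), !inner_delta in H.
  now rewrite <- (Cconj_conj (w n)), <- H, Cconj_conj.
Qed.

Lemma adjoint_fun_jacobi a b (A : operator) v :
  op_incl (Jmin a b) A -> dom (adjoint A) v ->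
  opfun (adjoint A) v = jacobi a b v /\ adjoint_rel A v (jacobi a b v).
Proof.
  intros HA Hv.
  assert (H : adjoint_rel A v (opfun (adjoint A) v)) by (simpl; now apply epsilon_spec).
  pose proof (adjoint_rel_jacobi a b A v _ HA H) as E.
  split; [exact E | now rewrite E in H].
Qed.

Lemma l2_truncation (u : cseq) (eps : R) :
  l2 u -> (0 < eps)%R ->
  exists (v : cseq) (N : nat), (forall n, (N <= n)%nat -> v n = 0) /\
              (l2norm (fun n => (u n - v n)%C) < eps)%R.
Proof.
  intros Hu Heps.
  unfold l2 in Hu. set (t := fun n => (Cmod (u n) ^ 2)%R) in Hu.
  pose proof (Series_correct _ Hu) as Hlim.
  apply (is_lim_seq_spec _ (Series t)) in Hlim.
  assert (He : (0 < eps * eps)%R) by nra.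
  destruct (Hlim (mkposreal _ He)) as [N HN]. specialize (HN N (le_n N)). simpl in HN.
  (* The partial sum up to [N] includes the index [N], so the truncation keeps it and vanishes from
     [S N] on. *)
  exists (fun n => if Nat.leb n N then u n else RtoC 0), (S N). split.
  - intros n Hn. destruct (Nat.leb_spec n N); [lia | reflexivity].
  - unfold l2norm.
    set (w := fun n => (Cmod (u n - (if Nat.leb n N then u n else RtoC 0)) ^ 2)%R).
    assert (Hw0 : forall n, (n <= N)%nat -> w n = 0%R).
    { intros n Hn. unfold w. destruct (Nat.leb_spec n N); [|lia].
      replace (u n - u n) with (RtoC 0) by ring. rewrite Cmod_0. ring. }
    assert (Hw1 : forall n, w (S N + n)%nat = t (S N + n)%nat).
    { intros n. unfold w, t. destruct (Nat.leb_spec (S N + n) N); [lia|].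
      do 2 f_equal. ring. }
    assert (Sw : ex_series w).
    { apply (ex_series_incr_n w (S N)).
      apply (ex_series_ext (fun n => t (S N + n)%nat)).
      - intros n. symmetry. apply Hw1.
      - apply (ex_series_incr_n t). exact Hu. }
    assert (E : (Series w < eps * eps)%R).
    { rewrite (Series_incr_n w (S N)) by (lia || exact Sw).
      rewrite (Series_incr_n t (S N)) in HN by (lia || exact Hu).
      simpl pred in *. rewrite (Series_ext _ _ Hw1).
      replace (sum_f_R0 w N) with 0%R.
      - rewrite sum_n_Reals in HN. apply Rabs_lt_between in HN. lra.
      - symmetry. rewrite (sum_eq w (fun _ => 0%R)); [|intros i Hi; now apply Hw0].
        rewrite sum_cte. ring. }
    (* The value of [sqrt] at negative arguments is 0, which settles the second case. *)
    destruct (Rle_lt_dec 0 (Series w)) as [H|H].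
    + rewrite <- (sqrt_square eps) by lra. apply sqrt_lt_1_alt. lra.
    + rewrite sqrt_neg_0; lra.
Qed.

(** * The boundary form, and surjectivity of the boundary values *)

Lemma wronskian_weighted a u v (n : nat) :
  (forall n, 0 < a n)%R ->
  wronskian a u v n
  = RtoC (sqrt (a n) / sqrt (a (S n)))
    * (weighted a u (S n) * weighted a v n - weighted a u n * weighted a v (S n)).
Proof.
  intros ha. unfold wronskian, weighted.
  pose proof (sqrt_lt_R0 _ (ha (S n))).
  rewrite RtoC_div by lra.
  assert (E : RtoC (a n) = sqrt (a n) * sqrt (a n))
    by (rewrite <- RtoC_mult, sqrt_sqrt; [reflexivity | left; apply ha]).
  rewrite E. field. now apply RtoC_sqrt_neq_0.
Qed.

Lemma wronskian_lim_0 am1 a b N sigma m K u v s t L :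
  regime am1 a b N sigma m K ->
  asymptotics am1 a b u s -> asymptotics am1 a b v t ->
  Clim (wronskian a u v) L ->
  (L = 0 <-> fst s * snd t = snd s * fst t).
Proof.
  intros HR Hs Ht HL. pose proof (reg_a HR) as ha.
  apply (asymptotics_tail _ _ _ _ _ N ha) in Hs.
  apply (asymptotics_tail _ _ _ _ _ N ha) in Ht.
  refine (weighted_bracket_lim_0 _ _ _ _ _ _ _ _ _ _ _ _ (reg_osc HR)
            (reg_m HR) (reg_ratio HR) Hs Ht _).
  apply (Clim_shift _ _ N) in HL. revert HL. apply Clim_ext.
  intros n. now rewrite wronskian_weighted.
Qed.

Arguments wronskian_lim_0 {am1 a b N sigma m K u v s t L} _.

(** The difference of the scalar products is the limit of the Wronskian of [u] and [conj_seq v].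
    Conjugation swaps the coefficients of [v], which turns the determinant condition into this
    Hermitian one. *)
Lemma boundary_form am1 a b N sigma m K u v s t :
  regime am1 a b N sigma m K ->
  dom (Jmax a b) u -> dom (Jmax a b) v ->
  asymptotics am1 a b u s -> asymptotics am1 a b v t ->
  (inner (jacobi a b u) v = inner u (jacobi a b v)
   <-> fst s * Cconj (fst t) = snd s * Cconj (snd t)).
Proof.
  intros HR [Hu HJu] [Hv HJv] Hs Ht. pose proof (reg_a HR) as ha.
  assert (HL : Clim (wronskian a u (conj_seq v))
                 (inner (jacobi a b u) v - inner u (jacobi a b v)))
    by (apply green_lim; now apply l2_product_summable).
  apply (asymptotics_conj _ _ _ _ _ ha) in Ht.
  rewrite <- (wronskian_lim_0 HR Hs Ht HL).
  split; intros H.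
  - rewrite H. ring.
  - replace (inner (jacobi a b u) v)
      with ((inner (jacobi a b u) v - inner u (jacobi a b v)) + inner u (jacobi a b v))
      by ring.
    rewrite H. ring.
Qed.

Arguments boundary_form {am1 a b N sigma m K u v s t} _.

(* The values at [n] and [n + 1]. *)
Fixpoint jacobi_solution_pair (a b : nat -> R) (u0 u1 : C) (n : nat) : C * C :=
  match n with
  | O => (u0, u1)
  | S m => let p := jacobi_solution_pair a b u0 u1 m in
           (snd p, - (a m * fst p + b (S m) * snd p) / a (S m))
  end.

Definition jacobi_solution a b u0 u1 : cseq :=
  fun n => fst (jacobi_solution_pair a b u0 u1 n).

Lemma jacobi_solution_eq a b u0 u1 (n : nat) :
  (forall n, 0 < a n)%R -> jacobi a b (jacobi_solution a b u0 u1) (S n) = 0.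
Proof.
  intros ha. unfold jacobi_solution; simpl. field.
  intros H. injection H as H. specialize (ha (S n)). lra.
Qed.

Lemma jacobi_solution_dom am1 a b N sigma m K u0 u1 :
  regime am1 a b N sigma m K -> dom (Jmax a b) (jacobi_solution a b u0 u1).
Proof.
  intros HR.
  assert (H : l2 (jacobi a b (jacobi_solution a b u0 u1))).
  { apply l2_finite with 1%nat. intros [|n] Hn; [lia|].
    apply jacobi_solution_eq, (reg_a HR). }
  split; [|exact H]. exact (l2_of_l2_jacobi _ _ _ _ _ _ _ _ HR H).
Qed.

Lemma Jmax_dom_linear a b (c : C) u v :
  dom (Jmax a b) u -> dom (Jmax a b) v -> dom (Jmax a b) (fun n => c * u n + v n).
Proof.
  intros [Hu HJu] [Hv HJv]. split; [now apply l2_linear|].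
  rewrite jacobi_linear. now apply l2_linear.
Qed.

(** [P] and [Q] solve the homogeneous equation in all rows but row 0, so their Wronskian is the
    constant [- a O]. Being nonzero, it makes their coefficient pairs linearly independent. *)
Lemma asymptotics_surjective am1 a b N sigma m K (x y : C) :
  regime am1 a b N sigma m K ->
  exists u, dom (Jmax a b) u /\ asymptotics am1 a b u (x, y).
Proof.
  intros HR. pose proof (reg_a HR) as ha.
  set (P := jacobi_solution a b 1 0). set (Q := jacobi_solution a b 0 1).
  assert (HP : dom (Jmax a b) P) by exact (jacobi_solution_dom _ _ _ _ _ _ _ _ _ HR).
  assert (HQ : dom (Jmax a b) Q) by exact (jacobi_solution_dom _ _ _ _ _ _ _ _ _ HR).
  destruct (asymptotics_exists _ _ _ _ _ _ _ P HR (proj2 HP)) as [s Hs].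
  destruct (asymptotics_exists _ _ _ _ _ _ _ Q HR (proj2 HQ)) as [t Ht].
  assert (HW : forall n, wronskian a P Q n = - RtoC (a O)).
  { induction n as [|n IH].
    - unfold wronskian, P, Q, jacobi_solution; simpl. ring.
    - pose proof (wronskian_step a b P Q n) as H.
      unfold P at 1, Q at 2 in H. rewrite !jacobi_solution_eq in H by exact ha.
      replace (wronskian a P Q (S n))
        with ((wronskian a P Q (S n) - wronskian a P Q n) + wronskian a P Q n) by ring.
      rewrite <- H, IH. ring. }
  assert (HL : Clim (wronskian a P Q) (- RtoC (a O)))
    by (refine (Clim_ext _ _ _ _ (Clim_const _)); intros n; symmetry; apply HW).
  assert (HD : fst s * snd t - snd s * fst t <> 0).
  { intros H.
    assert (E : - RtoC (a O) = 0).
    { apply (wronskian_lim_0 HR Hs Ht HL).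
      replace (fst s * snd t) with ((fst s * snd t - snd s * fst t) + snd s * fst t) by ring.
      rewrite H. ring. }
    injection E as E _. specialize (ha O). lra. }
  set (D := fst s * snd t - snd s * fst t) in *.
  (* Cramer's rule for [c s + d t = (x, y)]. The summand [zero_seq] below gives the combination the
     shape [c * u + v] at both levels. *)
  set (c := (x * snd t - y * fst t) / D). set (d := (fst s * y - snd s * x) / D).
  exists (fun n => c * P n + (d * Q n + zero_seq n)).
  assert (Hz : forall n, (0 <= n)%nat -> zero_seq n = 0) by reflexivity.
  split.
  - apply (Jmax_dom_linear a b c P); [exact HP|].
    apply (Jmax_dom_linear a b d Q); [exact HQ|].
    split; [exact (l2_finite _ _ Hz) | exact (l2_finite _ _ (jacobi_finite _ _ _ _ Hz))].
  - pose proof (asymptotics_linear _ _ _ _ _ _ _ c ha Hs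
      (asymptotics_linear _ _ _ _ _ _ _ d ha Ht (asymptotics_finite am1 a b _ _ ha Hz))) as H.
    simpl in H.
    replace (x, y) with (c * fst s + (d * fst t + 0), c * snd s + (d * snd t + 0));
      [exact H|].
    unfold c, d. apply injective_projections; simpl; unfold D; field; exact HD.
Qed.

(** * Self-adjointness of the operators [J_omega], and the converse *)

Lemma J_omega_dom_iff am1 a b N sigma m K omega u :
  regime am1 a b N sigma m K ->
  (dom (J_omega am1 a b omega) u <->
   dom (Jmax a b) u /\ exists s, asymptotics am1 a b u s /\ fst s = omega * snd s).
Proof.
  intros HR. unfold J_omega, s_plus, s_minus. simpl.
  split; intros [Hu H]; split; trivial.
  - destruct (asymptotics_exists _ _ _ _ _ _ _ u HR (proj2 Hu)) as [s Hs].
    rewrite (s_pair_eq HR Hs) in H. now exists s.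
  - destruct H as [s [Hs H]]. now rewrite (s_pair_eq HR Hs).
Qed.

Arguments J_omega_dom_iff {am1 a b N sigma m K omega u} _.

Lemma J_omega_contains_Jmin am1 a b N sigma m K omega :
  regime am1 a b N sigma m K -> op_incl (Jmin a b) (J_omega am1 a b omega).
Proof.
  intros HR u [M Hu]. split; [|reflexivity].
  apply (proj2 (J_omega_dom_iff HR)). split.
  - split; [exact (l2_finite _ _ Hu) | exact (l2_finite _ _ (jacobi_finite _ _ _ _ Hu))].
  - exists (RtoC 0, RtoC 0). split; [|simpl; ring].
    exact (asymptotics_finite _ _ _ _ _ (reg_a HR) Hu).
Qed.

(** On the line [s_+ = omega s_-] the two sides of the boundary condition differ by the factor
    [omega * Cconj omega = 1]. *)
Lemma J_omega_symmetric am1 a b N sigma m K omega u v :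
  regime am1 a b N sigma m K -> Cmod omega = 1%R ->
  dom (J_omega am1 a b omega) u -> dom (J_omega am1 a b omega) v ->
  inner (jacobi a b u) v = inner u (jacobi a b v).
Proof.
  intros HR Hom Hu Hv.
  apply (proj1 (J_omega_dom_iff HR)) in Hu.
  apply (proj1 (J_omega_dom_iff HR)) in Hv.
  destruct Hu as [Hu [s [Hs Es]]]. destruct Hv as [Hv [t [Ht Et]]].
  apply (boundary_form HR Hu Hv Hs Ht).
  rewrite Es, Et, Cmult_conj.
  transitivity (omega * Cconj omega * (snd s * Cconj (snd t))); [ring|].
  rewrite (Cconj_unit _ Hom). ring.
Qed.

(** One test vector suffices: against [u] with coefficients [(omega, 1)] the boundary form gives
    [omega * Cconj t_+ = Cconj t_-]. Conjugating and multiplying by [omega] yields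
    [t_+ = omega t_-]. *)
Lemma J_omega_adjoint_dom am1 a b N sigma m K omega v :
  regime am1 a b N sigma m K -> Cmod omega = 1%R ->
  adjoint_rel (J_omega am1 a b omega) v (jacobi a b v) ->
  dom (J_omega am1 a b omega) v.
Proof.
  intros HR Hom [Hv [HJv H]].
  assert (Hvd : dom (Jmax a b) v) by (split; assumption).
  destruct (asymptotics_exists _ _ _ _ _ _ _ v HR HJv) as [t Ht].
  destruct (asymptotics_surjective _ _ _ _ _ _ _ omega 1 HR) as [u [Hu Hs]].
  apply (proj2 (J_omega_dom_iff HR)). split; [exact Hvd|].
  exists t. split; [exact Ht|].
  assert (Hud : dom (J_omega am1 a b omega) u).
  { apply (proj2 (J_omega_dom_iff HR)). split; [exact Hu|].
    exists (omega, RtoC 1). split; [exact Hs | simpl; ring]. }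
  pose proof (proj1 (boundary_form HR Hu Hvd Hs Ht) (H u Hud)) as E.
  simpl in E. rewrite Cmult_1_l in E.
  rewrite <- (Cconj_conj (snd t)), <- E, Cmult_conj, Cconj_conj.
  rewrite Cmult_assoc, (Cconj_unit _ Hom). ring.
Qed.

Lemma J_omega_self_adjoint am1 a b N sigma m K omega :
  regime am1 a b N sigma m K -> Cmod omega = 1%R ->
  self_adjoint (J_omega am1 a b omega).
Proof.
  intros HR Hom. pose proof (reg_a HR) as ha.
  pose proof (J_omega_contains_Jmin _ _ _ _ _ _ _ omega HR) as Hmin.
  split; [split; [|split]|split; [|split]].
  - intros u Hu. apply (proj1 (J_omega_dom_iff HR)) in Hu. exact (proj1 Hu).
  - apply Hmin. exists O. reflexivity.
  - intros c u v Hu Hv. split; [|apply jacobi_linear].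
    apply (proj1 (J_omega_dom_iff HR)) in Hu.
  apply (proj1 (J_omega_dom_iff HR)) in Hv.
    apply (proj2 (J_omega_dom_iff HR)).
    destruct Hu as [Hu [s [Hs Es]]]. destruct Hv as [Hv [t [Ht Et]]].
    split; [exact (Jmax_dom_linear _ _ _ _ _ Hu Hv)|].
    eexists. split; [exact (asymptotics_linear _ _ _ _ _ _ _ c ha Hs Ht)|].
    simpl. rewrite Es, Et. ring.
  - intros u Hu eps Heps.
    destruct (l2_truncation u eps Hu Heps) as [v [M [Hv Hn]]].
    exists v. split; [|exact Hn]. apply Hmin. now exists M.
  - intros v Hv.
    assert (Hrel : adjoint_rel (J_omega am1 a b omega) v (jacobi a b v)).
    { destruct (proj1 (J_omega_dom_iff HR) Hv) as [[Hl HJ] _].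
      split; [exact Hl|]. split; [exact HJ|].
      intros u Hu. exact (J_omega_symmetric _ _ _ _ _ _ _ _ _ _ HR Hom Hu Hv). }
    assert (Hd : dom (adjoint (J_omega am1 a b omega)) v) by (now exists (jacobi a b v)).
    split; [exact Hd|].
    now rewrite (proj1 (adjoint_fun_jacobi _ _ _ _ Hmin Hd)).
  - intros v Hv. destruct (adjoint_fun_jacobi _ _ _ _ Hmin Hv) as [E Hrel].
    split; [|exact E].
    exact (J_omega_adjoint_dom _ _ _ _ _ _ _ _ _ HR Hom Hrel).
Qed.

Lemma Cmult_conj_self_eq_0 (x : C) : x * Cconj x = 0 -> x = 0.
Proof.
  intros H. apply Cmod_eq_0. rewrite <- Cmod2_conj in H.
  apply RtoC_inj in H. simpl in H. nra.
Qed.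

(* The boundary form vanishes on [D]; hence the pairs (s_+, s_-) arising from [D] lie on one
   line [s_+ = omega * s_-]. *)
Lemma isotropic_pairs_line (D : C * C -> Prop) :
  (forall s t, D s -> D t -> fst s * Cconj (fst t) = snd s * Cconj (snd t)) ->
  exists omega, Cmod omega = 1%R /\ forall s, D s -> fst s = omega * snd s.
Proof.
  intros H.
  destruct (excluded_middle_informative (exists t, D t /\ snd t <> 0)) as [[t [Ht Hnz]]|Hno].
  (* One pair [t] with nonzero second entry fixes [omega]: the form on [(t, t)] gives modulus one,
     and the form on [(s, t)] puts every [s] on the same line. *)
  - pose proof (H t t Ht Ht) as Htt.
    exists (fst t / snd t). split.
    + assert (E : Cmod (fst t) = Cmod (snd t)).
      { rewrite <- !Cmod2_conj in Htt. apply RtoC_inj in Htt.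
        pose proof (Cmod_ge_0 (fst t)). pose proof (Cmod_ge_0 (snd t)). nra. }
      rewrite Cmod_div by exact Hnz. rewrite E. field.
      apply Rgt_not_eq. now apply Cmod_gt_0.
    + intros s Hs. pose proof (H s t Hs Ht) as Hst.
      assert (Hcnz : Cconj (snd t) <> 0).
      { intros E. apply Hnz. rewrite <- (Cconj_conj (snd t)), E.
        apply injective_projections; simpl; ring. }
      assert (E : fst s * (snd t * Cconj (snd t)) = snd s * (fst t * Cconj (snd t))).
      { rewrite <- Htt.
        transitivity (fst t * (fst s * Cconj (fst t))); [ring|]. rewrite Hst. ring. }
      replace (fst s) with (fst s * (snd t * Cconj (snd t)) / (snd t * Cconj (snd t)))
        by (field; split; assumption).
      rewrite E. field. split; assumption.
  (* If all second entries vanish, the form on [(s, s)] kills the first entries too, and any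
     unimodular number serves. *)
  - exists (RtoC 1). split; [apply Cmod_1|].
    intros s Hs.
    assert (E : snd s = 0).
    { destruct (excluded_middle_informative (snd s = 0)) as [E|E]; [exact E|].
      exfalso. apply Hno. now exists s. }
    rewrite E. rewrite Cmult_0_r. apply Cmult_conj_self_eq_0.
    rewrite (H s s Hs Hs), E. ring.
Qed.

(** Symmetry makes the boundary pairs of [J] isotropic, so [J] is contained in some [J_omega].
    Symmetry of [J_omega] then puts its domain into that of the adjoint of [J], which is [J]
    itself. *)
Lemma self_adjoint_is_J_omega am1 a b N sigma m K J :
  regime am1 a b N sigma m K ->
  op_incl (Jmin a b) J -> self_adjoint J -> op_incl J (Jmax a b) ->
  exists omega, Cmod omega = 1%R /\ op_eq J (J_omega am1 a b omega).
Proof.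
  intros HR Hmin [_ [_ [HJ HJ']]] Hmax.
  assert (Hfun : forall u, dom J u -> opfun J u = jacobi a b u)
    by (intros u Hu; exact (proj2 (Hmax u Hu))).
  assert (Hsym : forall u v, dom J u -> dom J v ->
            inner (jacobi a b u) v = inner u (jacobi a b v)).
  { intros u v Hu Hv. destruct (HJ v Hv) as [Hd _].
    destruct (adjoint_fun_jacobi _ _ _ _ Hmin Hd) as [_ [_ [_ H]]].
    rewrite <- (Hfun u Hu). now apply H. }
  destruct (isotropic_pairs_line (fun s => exists u, dom J u /\ asymptotics am1 a b u s))
    as [omega [Hom Hline]].
  { intros s t [u [Hu Hs]] [v [Hv Ht]].
    apply (boundary_form HR
             (proj1 (Hmax u Hu)) (proj1 (Hmax v Hv)) Hs Ht).
    now apply Hsym. }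
  exists omega. split; [exact Hom|].
  assert (Hsub : forall u, dom J u -> dom (J_omega am1 a b omega) u).
  { intros u Hu. pose proof (proj1 (Hmax u Hu)) as Hud.
    apply (proj2 (J_omega_dom_iff HR)). split; [exact Hud|].
    destruct (asymptotics_exists _ _ _ _ _ _ _ u HR (proj2 Hud)) as [s Hs].
    exists s. split; [exact Hs|]. apply Hline. now exists u. }
  split.
  - intros u Hu. split; [now apply Hsub | now apply Hfun].
  - intros u Hu.
    assert (Hd : dom (adjoint J) u).
    { exists (jacobi a b u).
      destruct (proj1 (J_omega_dom_iff HR) Hu) as [[Hl HJl] _].
      split; [exact Hl|]. split; [exact HJl|].
      intros v Hv. rewrite (Hfun v Hv).
      exact (J_omega_symmetric _ _ _ _ _ _ _ _ _ _ HR Hom (Hsub v Hv) Hu). }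
    destruct (HJ' u Hd) as [Hu' _]. split; [exact Hu'|].
    now rewrite (Hfun u Hu').
Qed.

Theorem theorem3p9 (a b : nat -> R) (am1 : R) (beta_inf : R)
  (ha : forall n, (0 < a n)%R)
  (ham1 : (0 < am1)%R)
  (hsum : ex_series (fun n => (/ a n)%R))
  (hbeta : is_lim_seq (beta am1 a b) beta_inf)
  (hbeta_inf : (Rabs beta_inf < 1)%R)
  (hk : ex_series (fun n => Rabs (kappa am1 a n - 1)))
  (hdbeta : ex_series (fun n => Rabs (beta am1 a b (S n) - beta am1 a b n))) :
  (forall omega : C, Cmod omega = 1%R -> self_adjoint (J_omega am1 a b omega))
  /\
  (forall J : operator,
     op_incl (Jmin a b) J -> self_adjoint J -> op_incl J (Jmax a b) ->
     exists omega : C, Cmod omega = 1%R /\ op_eq J (J_omega am1 a b omega)).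
Proof.
  destruct (regime_exists a b am1 beta_inf ha hsum hbeta hbeta_inf hk hdbeta)
    as [N [sigma [m [K HR]]]].
  split.
  - intros omega Hom. exact (J_omega_self_adjoint _ _ _ _ _ _ _ _ HR Hom).
  - intros J Hmin Hsa Hmax. exact (self_adjoint_is_J_omega _ _ _ _ _ _ _ _ HR Hmin Hsa Hmax).
Qed.
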